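(* Let $n$ be a positive integer. Then $n$ is a cycle count number (that is, there is an inseparable graph with exactly $n$ cycles) if and only if $n \notin \{2, 4, 5, 8, 9, 16\}$.
   Context: Graphs are finite; multiple (parallel) edges are allowed but loops are not. A cycle is a connected 2-regular subgraph; in particular two parallel edges with their common endpoints form a cycle of length 2. Cycles are counted as subgraphs (equivalently, as edge sets). A graph is inseparable if it is connected and has no cutpoint (cut vertex); for loop-free graphs with more than two vertices this is the same as 2-connectivity. A cycle count number is a positive integer that is the number of cycles in some inseparable graph. *)

(* Defs.v *)
From mathcomp Require Import all_boot.

Set Implicit Arguments.
Unset Strict Implicit.
Unset Printing Implicit Defensive.

(* Finite loopless multigraphs: [ends] need not be injective, so that parallel
   edges are allowed, and the cardinality condition excludes loops. *)
Record mgraph := MGraph {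
  vertex : finType;
  edge : finType;
  ends : edge -> {set vertex};
  card_ends : forall e, #|ends e| = 2
}.

Section Graph.
Variable G : mgraph.

(* A pair of a vertex set and an edge set; it is a subgraph of G when it
   satisfies [is_subgraph]. *)
Definition vepair := ({set vertex G} * {set edge G})%type.

Implicit Type H : vepair.

Definition is_subgraph H : bool := [forall e in H.2, ends e \subset H.1].

Definition whole : vepair := ([set: vertex G], [set: edge G]).

Definition delete_vertex (v : vertex G) : vepair :=
  ([set~ v], [set e : edge G | v \notin ends e]).

Definition adj H : rel (vertex G) :=
  fun x y => [exists e in H.2, ends e == [set x; y]].

(* The empty graph is not connected. *)
Definition connected H : bool :=
  (H.1 != set0) && [forall x in H.1, forall y in H.1, connect (adj H) x y].

Definition degree H (x : vertex G) : nat :=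
  #|[set e in H.2 | x \in ends e]|.

Definition regular (k : nat) H : bool := [forall x in H.1, degree H x == k].

Definition is_cycle H : bool :=
  [&& is_subgraph H, connected H & regular 2 H].

Definition num_cycles : nat := #|[set H : vepair | is_cycle H]|.

Definition num_components H : nat := n_comp (adj H) H.1.

Definition cutpoint (v : vertex G) : bool :=
  num_components whole < num_components (delete_vertex v).

Definition inseparable : bool :=
  connected whole && [forall v, ~~ cutpoint v].

End Graph.

Definition cycle_count_number (n : nat) : Prop :=
  0 < n /\ exists G : mgraph, inseparable G /\ num_cycles G = n.

(* Main.v *)
Require Import Defs.
From mathcomp Require Import all_boot zify.

(** Everything is read off from edge sets. The even edge sets (all degrees
    even) form a binary code, and the cycles are its minimal nonempty words
    ([num_cyclesE]), so that counting cycles is counting minimal words.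

    The six values are missing already for codes. In an inseparable graph the
    cycle space does not split along any partition of the edges
    ([cycle_space_indecomposable]): at a vertex where the two parts meet, the
    absence of a cutpoint gives a closed walk leaving by an edge of one part
    and returning by an edge of the other. Relative to an information set [I]
    of such a code, each coordinate is a vector of length #|I|, words are
    linear functionals, and the minimal words are the functionals with minimal
    support on the set of coordinate vectors. Enlarging a set of vectors can
    only create new minimal functionals, so a search over the sets of vectors
    that stops as soon as 17 minimal functionals have appeared is short, and it
    settles all lengths up to 6 ([check_passes]): the six values do not occur
    in length at most 5, and length 6 gives at least 17. Longer codes are
    compared with six of their coordinates, chosen so that the vectors remain
    linked ([linked_order]); they too have at least 17 minimal words.

    For the converse, a graph with two marked vertices is measured by its
    number c of cycles and its number p of paths between them. A new vertex
    joined to the marked ones by a and b parallel edges turns (c, p) into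
    (c + C(a,2) + C(b,2) + pab, p + ab) ([realizable_bundle]). Call
    C(p,2) - c the deficiency, which vanishes for p parallel edges: the
    operation adds to it an amount depending on a and b only, 0 for (1,1),
    4 for (2,2), 11 for (2,3) and 21 for (2,4), while p grows by ab. Since the
    deficiency can grow by more than p does, every deficiency d with
    11 <= d < 11 + p is attained once p >= 15 ([deficient_large]), and the
    numbers C(p,2) - d in these windows cover all integers from 81 on. The
    remaining values come from nine small starting graphs, whose cycles and
    paths are counted by enumeration of edge sets. *)

Set Implicit Arguments.
Unset Strict Implicit.
Unset Printing Implicit Defensive.

(** * Edge sets modulo 2 and their boundaries *)

Definition symdiff (T : finType) (A B : {set T}) : {set T} :=
  [set x | (x \in A) (+) (x \in B)].
Notation "A :+: B" := (symdiff A B) (at level 52, left associativity).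

Section SymDiff.
Variable T : finType.
Implicit Types A B C : {set T}.

Lemma in_symdiff x A B : (x \in A :+: B) = (x \in A) (+) (x \in B).
Proof. by rewrite inE. Qed.

Lemma symdiff0 A : A :+: set0 = A.
Proof. by apply/setP=> x; rewrite !inE addbF. Qed.

Lemma symdiffv A : A :+: A = set0.
Proof. by apply/setP=> x; rewrite !inE addbb. Qed.

Lemma symdiff_eq0 A B : (A :+: B == set0) = (A == B).
Proof.
apply/eqP/eqP=> [/setP AB0 | ->]; last exact: symdiffv.
by apply/setP=> x; move: (AB0 x); rewrite !inE; case: (x \in A) (x \in B) => [] [].
Qed.

Lemma symdiff_sub A B C : A \subset C -> B \subset C -> A :+: B \subset C.
Proof.
move=> sAC sBC; apply/subsetP=> x; rewrite inE.
by case xA: (x \in A); [rewrite (subsetP sAC) | move=> /(subsetP sBC)].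
Qed.

Lemma odd_card A : odd #|A| = \big[addb/false]_x (x \in A).
Proof.
rewrite -sum1_card (@big_morph _ _ odd false addb 0 addn oddD erefl) big_mkcond.
by apply: eq_bigr => x _; case: (x \in A).
Qed.

End SymDiff.

Section Boundary.
Variable G : mgraph.
Implicit Types (Z F K : {set edge G}) (x y v : vertex G).

Definition deg Z x := #|[set e in Z | x \in ends e]|.

Definition boundary Z : {set vertex G} := [set x | odd (deg Z x)].

Lemma boundaryE Z x :
  (x \in boundary Z) = \big[addb/false]_(e | x \in ends e) (e \in Z).
Proof.
rewrite inE odd_card [RHS]big_mkcond; apply: eq_bigr => e _.
by rewrite inE andbC; case: ifP.
Qed.

Lemma boundary_symdiff Z F : boundary (Z :+: F) = boundary Z :+: boundary F.
Proof.
apply/setP=> x; rewrite in_symdiff !boundaryE -big_split /=.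
by apply: eq_bigr => e _; rewrite in_symdiff.
Qed.

Lemma boundary0 : boundary set0 = set0.
Proof. by rewrite -(symdiffv set0) boundary_symdiff symdiffv. Qed.

Lemma boundary1 e : boundary [set e] = ends e.
Proof.
apply/setP=> x; rewrite inE /deg; case xe: (x \in ends e).
  rewrite (_ : [set _ in _ | _] = [set e]) ?cards1 //.
  by apply/setP=> f; rewrite !inE; case: eqP => // ->.
rewrite (_ : [set _ in _ | _] = set0) ?cards0 //.
by apply/setP=> f; rewrite !inE; case: eqP => // ->.
Qed.

Lemma degU1 e Z x : e \notin Z -> deg (e |: Z) x = (x \in ends e) + deg Z x.
Proof.
move=> eZ; rewrite /deg; have [xe|xe] := boolP (x \in ends e).
  rewrite (_ : [set f in _ | _] = e |: [set f in Z | x \in ends f]).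
    by rewrite cardsU1 !inE (negPf eZ).
  by apply/setP=> f; rewrite !inE; case: eqP => // ->.
rewrite add0n; apply: eq_card => f; rewrite !inE.
case: eqP => [->|_] /=; last by []. by rewrite (negPf xe) andbF.
Qed.

Lemma endsP e x : x \in ends e -> exists2 y, x != y & ends e = [set x; y].
Proof.
move=> xe; have /cards2P[a [b [ab eE]]]: #|ends e| == 2 by rewrite card_ends.
move: xe; rewrite eE !inE => /orP[]/eqP->; first by exists b.
by exists a; rewrite 1?setUC // eq_sym.
Qed.

Lemma adj_sym (H : vepair G) : symmetric (adj H).
Proof. by move=> x y; apply: eq_existsb => e; rewrite setUC. Qed.

Lemma adj_csym (H : vepair G) : connect_sym (adj H).
Proof. exact/sym_connect_sym/adj_sym. Qed.

Lemma adjP (H : vepair G) x y :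
  reflect (exists2 e, e \in H.2 & ends e = [set x; y]) (adj H x y).
Proof.
apply: (iffP exists_inP) => [] [e eH /eqP eE]; exists e => //; exact/eqP.
Qed.

(** Counting incidences of [Z] with [W] edge by edge, each edge contributes 0 or
    2. For [W] a connected component this is the fact that odd degrees come in
    pairs. *)
Lemma handshake Z (W : {set vertex G}) :
  (forall e, e \in Z -> ends e \subset W \/ [disjoint ends e & W]) ->
  ~~ odd #|boundary Z :&: W|.
Proof.
move=> ZW; rewrite odd_card.
have -> : \big[addb/false]_x (x \in boundary Z :&: W) =
          \big[addb/false]_(x in W) \big[addb/false]_(e | x \in ends e) (e \in Z).
  rewrite [RHS]big_mkcond; apply: eq_bigr => x _.
  by rewrite inE boundaryE andbC; case: ifP.
rewrite (exchange_big_dep xpredT) //= big1 // => e _.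
have [eZ|eZ] := boolP (e \in Z); last by rewrite big1.
rewrite (_ : \big[_/_]_(_ | _) _ = odd #|ends e :&: W|); last first.
  rewrite odd_card big_mkcond; apply: eq_bigr => x _.
  by rewrite inE [_ && _]andbC; case: (_ && _).
by case: (ZW e eZ) => [/setIidPl-> | /disjoint_setI0->]; rewrite ?card_ends ?cards0.
Qed.

(** The degree formula encodes the three cases at once: 2 inside, 1 at the two
    ends, 0 elsewhere, and 0 at the only vertex of an empty path. *)
Lemma path_edges (H : vepair G) x p :
  path (adj H) x p -> uniq (x :: p) ->
  exists P : {set edge G},
  [/\ P \subset H.2, forall e, e \in P -> {subset ends e <= x :: p},
      forall w, deg P w + (w == x) + (w == last x p) = 2 * (w \in x :: p)
    & forall W w, w \in x :: p -> connect (adj (W, P)) x w].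
Proof.
elim: p x => [|y p IHp] x.
  move=> _ _; exists set0; split=> [|e|w|W w]; rewrite ?sub0set ?inE //; last first.
    by move/eqP->.
  rewrite /deg (_ : [set _ in _ | _] = set0) ?cards0 /=; last by apply/setP=> f; rewrite !inE.
  by rewrite add0n; case: eqP.
rewrite [path _ _ _]/= => /andP[/adjP[e eH eE] yp]; rewrite cons_uniq => /andP[xyp uyp].
have [P [PH Pends Pdeg Pcon]] := IHp y yp uyp.
have eP : e \notin P by apply/negP=> /Pends/(_ x); rewrite (negPf xyp) eE !inE eqxx => /(_ isT).
have xy : x != y by apply: contraNneq xyp => ->; rewrite mem_head.
exists (e |: P); split.
- by rewrite subUset sub1set eH.
- move=> f /setU1P[->|/Pends fP] w; last by move/fP; rewrite [w \in x :: _]inE orbC => ->.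
  by rewrite eE !inE orbA => ->.
- move=> w; rewrite [last _ _]/=.
  rewrite degU1 // eE !inE; move: (Pdeg w); rewrite inE.
  have [->|wx] := eqVneq w x; last by rewrite /=; lia.
  move: xyp; rewrite inE negb_or => /andP[/negPf-> /negPf->] /=; lia.
- move=> W w; rewrite inE => /orP[/eqP->//|wyp].
  apply: (@connect_trans _ _ y).
    by apply: connect1; apply/adjP; exists e; rewrite ?setU11.
  apply: connect_sub (Pcon W w wyp) => a b /adjP[f fP fE].
  by apply: connect1; apply/adjP; exists f; rewrite //= setU1r.
Qed.

End Boundary.

(** * Cycles as minimal even edge sets *)

(** For the empty [T] these are the minimal even edge sets; for [T] = {s, t}
    they are the edge sets of the paths from s to t. *)
Definition min_join (G : mgraph) (T : {set vertex G}) (Z : {set edge G}) :=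
  minset [pred F : {set edge G} | (F != set0) && (boundary F == T)] Z.

Notation circuit := (min_join set0).

Section Cycles.
Variable G : mgraph.
Implicit Types (Z F K : {set edge G}) (x y v : vertex G) (H : vepair G).

Lemma min_joinP (T : {set vertex G}) Z :
  reflect [/\ Z != set0, boundary Z = T
            & forall F, F \subset Z -> F != set0 -> boundary F = T -> F = Z]
    (min_join T Z).
Proof.
apply: (iffP minsetP) => [[/andP[Z0 /eqP bZ] minZ]|[Z0 bZ minZ]]; split=> //.
- by move=> F FZ F0 bF; apply: minZ; rewrite //= F0 bF eqxx.
- by rewrite /= Z0 bZ eqxx.
by move=> F /andP[F0 /eqP bF] FZ; apply: minZ.
Qed.

(** Removing an edge xy of [Z] leaves x and y as the only vertices of odd degree,
    hence, by the handshake lemma, in the same component. A simple path between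
    them closes up with xy to a cycle inside [Z], which is [Z] by minimality. *)
Lemma circuit_cycle Z : circuit Z -> exists2 H, is_cycle H & H.2 = Z.
Proof.
case/min_joinP=> /set0Pn[e eZ] bZ minZ.
have [x xe] : exists x, x \in ends e.
  by apply/set0Pn; rewrite -card_gt0 card_ends.
have [y xy eE] := endsP xe.
pose F := Z :\ e; pose H0 : vepair G := (setT, F).
have ZE : Z = F :+: [set e].
  by apply/setP=> f; rewrite !inE; case: eqP => [->|_]; rewrite ?eZ ?addbF.
have bF : boundary F = [set x; y].
  apply/eqP; rewrite -symdiff_eq0 -eE -boundary1 -boundary_symdiff -ZE; exact/eqP.
have /connectP[p0 xp0 lastp0] : connect (adj H0) x y.
  apply: contraT => xNy; pose W := [set w | connect (adj H0) x w].
  suff /handshake : forall f, f \in F -> ends f \subset W \/ [disjoint ends f & W].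
    rewrite bF (_ : _ :&: W = [set x]) ?cards1 //.
    apply/setP=> w; rewrite !inE.
    case: (eqVneq w x) => [->|_] /=; first exact: connect0.
    by case: eqP => // ->; rewrite (negPf xNy).
  move=> f fF; case: (boolP [disjoint ends f & W]) => [|/pred0Pn[a]]; first by right.
  case/andP=> af' aW'; left; have {af'} af : a \in ends f := af'; have {aW'} aW : a \in W := aW'.
  have [b ab fE] := endsP af; rewrite fE subUset !sub1set aW.
  move: aW; rewrite !inE => aW; apply: connect_trans aW (connect1 _).
  by apply/adjP; exists f.
have [p [xp up lastp]] : exists p, [/\ path (adj H0) x p, uniq (x :: p) & y = last x p].
  by move: lastp0; case/shortenP: xp0 => p ? ? _ ->; exists p.
have [P [PF Pends Pdeg Pcon]] := path_edges xp up.
have eP : e \notin P by apply: contraTN PF => eP; apply/subsetPn; exists e; rewrite // !inE eqxx.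
have degE w : deg (e |: P) w = 2 * (w \in x :: p).
  move: (Pdeg w); rewrite degU1 // eE -lastp !inE.
  case: (eqVneq w x) => [->|_]; first by rewrite (negPf xy) /=; lia.
  by rewrite /=; lia.
have eqZ : e |: P = Z.
  apply: minZ.
  - by rewrite subUset sub1set eZ (subset_trans PF) // subsetDl.
  - by apply/set0Pn; exists e; rewrite setU11.
  by apply/setP=> w; rewrite !inE degE mul2n odd_double.
exists ([set w in x :: p], Z) => //; apply/and3P; split=> /=.
- apply/forall_inP=> f; rewrite -eqZ => /setU1P[->|/Pends fP].
    rewrite eE subUset !sub1set !inE eqxx lastp /=.
    exact: mem_last.
  by apply/subsetP=> w /fP wp; rewrite /= inE.
- apply/andP; split; first by apply/set0Pn; exists x; rewrite !inE eqxx.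
  have con w : w \in x :: p -> connect (adj ([set w in x :: p], Z)) x w.
    move=> wp; apply: connect_sub (Pcon setT w wp) => a b /adjP[f fP fE].
    by apply: connect1; apply/adjP; exists f; rewrite //= -eqZ setU1r.
  apply/forall_inP=> a; rewrite inE => ap; apply/forall_inP=> b; rewrite inE => bp.
  by apply: connect_trans (con b bp); rewrite adj_csym con.
apply/forall_inP=> w; rewrite inE => wp.
by rewrite (_ : degree _ w = deg Z w) // -eqZ degE wp.
Qed.

(** An even subset of a 2-regular graph contains all or none of the edges at each
    vertex, so a nonempty one spreads along the connected graph. *)
Lemma cycle_circuit H : is_cycle H -> circuit H.2.
Proof.
case/and3P=> /forall_inP subH /andP[/set0Pn[x0 x0H] /forall_inP conH] /forall_inP regH.
have degH x : x \in H.1 -> deg H.2 x = 2 by move=> /regH/eqP.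
have eH e x : e \in H.2 -> x \in ends e -> x \in H.1.
  by move=> /subH/subsetP; apply.
apply/min_joinP; split.
- have: deg H.2 x0 != 0 by rewrite degH.
  by rewrite cards_eq0 => /set0Pn[e]; rewrite inE => /andP[? _]; apply/set0Pn; exists e.
- apply/setP=> x; rewrite !inE; have [xH|xH] := boolP (x \in H.1); first by rewrite degH.
  rewrite /deg (_ : [set _ in _ | _] = set0) ?cards0 //.
  by apply/setP=> e; rewrite !inE; apply: contraNF xH => /andP[/eH]; apply.
move=> F FH F0 bF.
have sub x : [set e in F | x \in ends e] \subset [set e in H.2 | x \in ends e].
  by apply/subsetP=> e; rewrite !inE => /andP[/(subsetP FH)-> ->].
have star e f x : e \in F -> x \in ends e -> f \in H.2 -> x \in ends f -> f \in F.
  move=> eF xe fH xf.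
  have xH : x \in H.1 by apply: eH xf.
  suff /setP/(_ f) : [set e in F | x \in ends e] = [set e in H.2 | x \in ends e].
    by rewrite !inE xf fH !andbT.
  apply/eqP; rewrite eqEcard sub -/(deg H.2 x) -/(deg F x) degH //=.
  have /setP/(_ x) := bF; rewrite !inE; have: deg F x != 0.
    by rewrite cards_eq0; apply/set0Pn; exists e; rewrite inE eF.
  by case: (deg F x) => [|[|]].
apply/eqP; rewrite eqEsubset FH; apply/subsetP=> f fH.
have [e eF] := set0Pn _ F0.
have [x xe] : exists x, x \in ends e by apply/set0Pn; rewrite -card_gt0 card_ends.
have [y yf] : exists x, x \in ends f by apply/set0Pn; rewrite -card_gt0 card_ends.
pose W := [set w | [exists g in F, w \in ends g]].
have clW : closed (adj H) W.
  apply: intro_closed => [|a b /adjP[g gH gE]]; first exact: adj_csym.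
  rewrite !inE => /exists_inP[k kF ak]; apply/exists_inP; exists g.
    by apply: star kF ak gH _; rewrite gE !inE eqxx.
  by rewrite gE !inE eqxx orbT.
have xH : x \in H.1 by apply: eH xe; apply: (subsetP FH).
have yH : y \in H.1 by apply: eH yf.
have := closed_connect clW (forall_inP (conH x xH) y yH).
rewrite !inE => /esym; rewrite (_ : [exists g in F, x \in ends g]); last first.
  by apply/exists_inP; exists e.
by case/exists_inP=> g gF yg; apply: star gF yg fH yf.
Qed.

Lemma cycle_inj : {in [pred H | is_cycle H] &, injective (fun H : vepair G => H.2)}.
Proof.
have VE H : is_cycle H -> H.1 = [set x | deg H.2 x != 0].
  case/and3P=> /forall_inP subH _ /forall_inP regH; apply/setP=> x; rewrite inE.
  have [xH|xH] := boolP (x \in H.1); first by rewrite [deg _ _](eqP (regH x xH)).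
  apply/esym/negbTE; rewrite negbK cards_eq0; apply/eqP/setP=> e; rewrite !inE.
  by apply: contraNF xH => /andP[/subH/subsetP sub xe]; apply: sub.
move=> H1 H2; rewrite !inE => /VE E1 /VE E2 /= eq2.
by case: H1 H2 E1 E2 eq2 => [V1 F1] [V2 F2] /= -> -> ->.
Qed.

Lemma num_cyclesE : num_cycles G = #|[set Z : {set edge G} | circuit Z]|.
Proof.
rewrite /num_cycles -(card_in_imset (f := fun H : vepair G => H.2)); last first.
  by move=> H1 H2; rewrite !inE => c1 c2; apply: cycle_inj; rewrite inE.
apply: eq_card => Z; rewrite inE; apply/imsetP/idP => [[H]|].
  by rewrite inE => cH ->; apply: cycle_circuit.
by case/circuit_cycle => H cH <-; exists H; rewrite ?inE.
Qed.

(** * Inseparability and the cycle space *)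

Lemma inseparableP :
  reflect [/\ exists x : vertex G, True, forall x y, connect (adj (whole G)) x y
            & forall v x y, x != v -> y != v -> connect (adj (delete_vertex v)) x y]
    (inseparable G).
Proof.
have cs H := @adj_csym G H.
have closedv v : closed (adj (delete_vertex v)) [set~ v].
  apply: intro_closed => // a b /adjP[e]; rewrite !inE => ve eE _.
  by apply: contraNneq ve => <-; rewrite eE !inE eqxx orbT.
have comp1 v : reflect (forall x y, x != v -> y != v -> connect (adj (delete_vertex v)) x y)
  (num_components (delete_vertex v) <= 1).
  have root_del x : x != v -> root (adj (delete_vertex v)) x != v.
    by move=> xv; move: (closed_connect (closedv v) (connect_root _ x)); rewrite !inE xv => <-.
  apply: (iffP card_le1_eqP) => [le1 x y xv yv|con x y].
    by apply/(rootP (cs _)); apply: le1; rewrite !inE roots_root //= root_del.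
  rewrite !inE => /andP[/eqP rx xv] /andP[/eqP ry yv].
  by rewrite -rx -ry; apply/(rootP (cs _)); apply: con.
have whole1 : connected (whole G) -> num_components (whole G) = 1.
  case/andP=> /set0Pn[x _] /forall_inP con.
  rewrite -(n_comp_connect (cs (whole G)) x); apply: eq_n_comp_r => y.
  rewrite inE; apply/esym; have := con x (in_setT _).
  by move/forall_inP; apply.
apply: (iffP andP) => [[con /forallP cut]|[[x0 _] con del]].
  split.
  - by case/andP: con => /set0Pn[x _] _; exists x.
  - by move=> x y; case/andP: con => _ /forall_inP/(_ x (in_setT _))/forall_inP; apply.
  by move=> v; apply/comp1; move: (cut v); rewrite /cutpoint -leqNgt whole1.
have conW : connected (whole G).
  apply/andP; split; first by apply/set0Pn; exists x0; rewrite inE.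
  by apply/forall_inP=> x _; apply/forall_inP=> y _.
by split=> //; apply/forallP=> v; rewrite /cutpoint -leqNgt whole1 //; apply/comp1/del.
Qed.

(** By connectedness some vertex v lies on an edge f1 in [E1] and on an edge f2
    outside. As v is not a cutpoint, the other ends of f1 and f2 are joined by a
    path avoiding v. Together with f1 and f2 it is an even edge set whose only
    edge of [E1] at v is f1. *)
Lemma cycle_space_indecomposable (E1 : {set edge G}) e1 e2 :
  inseparable G -> e1 \in E1 -> e2 \notin E1 ->
  exists2 Z, boundary Z = set0 & boundary (Z :&: E1) != set0.
Proof.
case/inseparableP=> _ con del e1E e2E.
have ex e : exists x, x \in ends e by apply/set0Pn; rewrite -card_gt0 card_ends.
have [v [f1 [f2 [f1E f2E vf1 vf2]]]] : exists v f1 f2,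
  [/\ f1 \in E1, f2 \notin E1, v \in ends f1 & v \in ends f2].
  pose W := [set w | [exists g in E1, w \in ends g]].
  pose B := [exists v, exists f1, exists f2,
    [&& f1 \in E1, f2 \notin E1, v \in ends f1 & v \in ends f2]].
  have [/existsP[v /existsP[f1 /existsP[f2 /and4P[]]]]|NB] := boolP B; first by exists v, f1, f2.
  have star e f x : e \in E1 -> x \in ends e -> x \in ends f -> f \in E1.
    move=> eE xe xf; apply: contraNT NB => fE.
    by apply/existsP; exists x; apply/existsP; exists e; apply/existsP; exists f; rewrite eE fE xe xf.
  have clW : closed (adj (whole G)) W.
    apply: intro_closed => [|a b /adjP[g _ gE]]; first exact: adj_csym.
    rewrite !inE => /exists_inP[k kF ak]; apply/exists_inP; exists g.
      by apply: star kF ak _; rewrite gE !inE eqxx.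
    by rewrite gE !inE eqxx orbT.
  have [[x xe] [y ye]] := (ex e1, ex e2).
  have := closed_connect clW (con x y); rewrite !inE => /esym.
  rewrite (_ : [exists g in E1, x \in ends g]); last by apply/exists_inP; exists e1.
  case/exists_inP=> g gE yg; case/negP: e2E; exact: star gE yg ye.
have [u1 vu1 f1V] := endsP vf1; have [u2 vu2 f2V] := endsP vf2.
have /connectP[p0 xp0 lastp0] : connect (adj (delete_vertex v)) u1 u2.
  by apply: del; rewrite eq_sym.
have [p [xp up lastp]] : exists p,
    [/\ path (adj (delete_vertex v)) u1 p, uniq (u1 :: p) & u2 = last u1 p].
  by move: lastp0; case/shortenP: xp0 => p ? ? _ ->; exists p.
have [P [Pdel _ Pdeg _]] := path_edges xp up.
have bP : boundary P = [set u1] :+: [set u2].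
  apply/setP=> w; rewrite !inE lastp.
  have := congr1 odd (Pdeg w); rewrite mul2n odd_double !oddD !oddb.
  by case: (odd _) (w == u1) (w == last u1 p) => [] [] [].
have NP f : v \in ends f -> f \in P = false.
  by move=> vf; apply: contraTF Pdel => fP; apply/subsetPn; exists f; rewrite // !inE negbK.
exists (P :+: ([set f1] :+: [set f2])).
  rewrite !boundary_symdiff !boundary1 bP f1V f2V; apply/setP=> w; rewrite !inE.
  have [->|_] := eqVneq w v; first by rewrite (negPf vu1) (negPf vu2).
  by case: (w == u1) (w == u2) => [] [].
apply/set0Pn; exists v; rewrite inE /deg (_ : [set _ in _ | _] = [set f1]) ?cards1 //.
apply/setP=> f; rewrite !inE.
have [->|_] := eqVneq f f1; first by rewrite f1E vf1 (NP _ vf1) (negPf (contraNneq _ f2E)) // => <-.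
have [->|_] := eqVneq f f2; first by rewrite (negPf f2E) andbF.
by rewrite addbF; case: (boolP (v \in ends f)) => [/NP->|_]; rewrite ?andbF.
Qed.

End Cycles.

(** * Minimal functionals on sets of binary vectors *)

(** Written with nested conditionals, rather than with the boolean connectives,
    because the search below evaluates it very often. *)
Fixpoint dot (u v : bitseq) : bool :=
  match u, v with
  | a :: u', b :: v' => if a then if b then ~~ dot u' v' else dot u' v' else dot u' v'
  | _, _ => false
  end.

Fixpoint vecs r : seq bitseq :=
  if r is r'.+1 then map (cons true) (vecs r') ++ map (cons false) (vecs r')
  else [:: [::]].

(** Componentwise implication, required to be proper when [strict] holds. *)
Fixpoint submask (u v : bitseq) strict : bool :=
  match u, v with
  | a :: u', b :: v' =>
     if a then if b then submask u' v' strict else false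
     else if b then submask u' v' false else submask u' v' strict
  | _, _ => ~~ strict
  end.

(** A state of the search lists, with each nonzero functional J, the nonzero
    functionals K properly below J whose support on the vectors met so far is
    contained in that of J; J is minimal when no such K is left. Only the K below
    J compete, because the unit vectors are always among the vectors. *)
Definition state := seq (bitseq * seq bitseq).

Definition refine v (st : state) : state :=
  [seq (if dot v p.1 then p else (p.1, [seq K <- p.2 | ~~ dot v K])) | p <- st].

Definition settled (st : state) : nat := count (fun p => nilp p.2) st.

Definition start r : state :=
  [seq (J, [seq K <- vecs r | has id K && submask K J true])
     | J <- [seq J <- vecs r | has id J]].

(** Such a vector links the coordinate k to an earlier one. *)
Definition crossing k (v : bitseq) := nth false v k && has id (take k v).

Definition linked r (L : seq bitseq) := all (fun k => has (crossing k) L) (iota 1 r.-1).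

(** The unit vectors belong to every set under consideration, and the zero vector
    separates no functionals, so the search decides on the vectors of weight at
    least 2. Taking the heaviest first keeps it short, as they destroy many
    inclusions between supports. *)
Definition heavy r := flatten [seq [seq v <- vecs r | count id v == w] | w <- rev (iota 2 r.-1)].

(** Each vector of [rem] is in turn put into the set [T] or discarded. A branch is
    closed when the vectors can no longer link all coordinates, or when 17
    functionals are minimal, since minimality persists when vectors are added. *)
Fixpoint check r (good : pred nat) (rem T : seq bitseq) (st : state) : bool :=
  if ~~ linked r (T ++ rem) then true else
  if 17 <= settled st then true else
  if rem is v :: rem' then
    if check r good rem' (v :: T) (refine v st) then check r good rem' T st else false
  else good (settled st).

(** The bound in length 6 is what passes to longer codes, for which six coordinates
    give only a lower bound on the number of minimal words. *)
Definition allowed_count r c := (c \notin [:: 2; 4; 5; 8; 9; 16]) && ((r == 6) ==> (17 <= c)).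

Lemma check_passes : all (fun r => check r (allowed_count r) (heavy r) [::] (start r)) (iota 1 6).
Proof. vm_compute. reflexivity. Qed.

Lemma dot_cons a u b v : dot (a :: u) (b :: v) = (a && b) (+) dot u v.
Proof. by case: a b => [] []. Qed.

Lemma mem_vecs r v : (v \in vecs r) = (size v == r).
Proof.
elim: r v => [|r IHr] [|b v] //=.
- by rewrite mem_cat; apply/negP=> /orP[] /mapP[].
rewrite mem_cat eqSS -IHr; apply/orP/idP => [[/mapP[w wv [_ ->]]|/mapP[w wv [_ ->]]]|vv] //.
by case: b; [left | right]; apply: map_f.
Qed.

Lemma vecs_uniq r : uniq (vecs r).
Proof.
elim: r => //= r IHr; rewrite cat_uniq !map_inj_uniq ?IHr /= => [|? ? []|? ? []] //.
by rewrite andbT; apply/hasPn=> _ /mapP[v _ ->]; apply/mapP=> -[].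
Qed.

Definition unit_vec r k := mkseq (eq_op k) r.

Lemma unit_vecS r k : unit_vec r.+1 k.+1 = false :: unit_vec r k.
Proof. by rewrite /unit_vec /mkseq /= (iotaDl 1 0) -map_comp. Qed.

Lemma unit_vec0 r : unit_vec r.+1 0 = true :: nseq r false.
Proof.
rewrite /unit_vec /mkseq /= (iotaDl 1 0) -map_comp; congr cons.
transitivity (nseq (size (iota 0 r)) false); last by rewrite size_iota.
by elim: (iota 0 r) => //= x l ->.
Qed.

Lemma dot0 r J : dot (nseq r false) J = false.
Proof. by elim: r J => [|r IHr] [|b J] //=. Qed.

Lemma dot_unit r k J : k < r -> dot (unit_vec r k) J = nth false J k.
Proof.
elim: r k J => [|r IHr] [|k] [|b J] // kr; rewrite ?unit_vecS ?unit_vec0 //=.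
  by rewrite dot0; case: b.
by rewrite IHr.
Qed.

(** Vectors of weight at most 1 compare functionals entry by entry, and this
    comparison is built into the initial state of the search. *)
Lemma light_vec r v J : size v = r -> count id v <= 1 -> dot v J ->
  exists2 k, k < r & v = unit_vec r k.
Proof.
elim: r v J => [|r IHr] [|a v] [|b J] // [sv].
rewrite dot_cons /=; case: a => /= [|cv dv].
  rewrite add1n ltnS leqn0 -[_ == 0]negbK -lt0n -has_count => v0 _; exists 0 => //.
  rewrite unit_vec0; congr cons; apply: (@eq_from_nth _ false) => [|i iv]; rewrite ?size_nseq //.
  rewrite nth_nseq -sv iv; apply: contraNF v0 => vi; apply/hasP; exists true => //.
  by rewrite -vi mem_nth.
have [k kr ->] := IHr v J sv cv dv.
by exists k.+1; rewrite ?unit_vecS.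
Qed.

Lemma proper_submaskP u v : size u = size v ->
  reflect ((forall k, nth false u k -> nth false v k) /\ u <> v) (submask u v true).
Proof.
pose P (b : bool) u v := (forall k, nth false u k -> nth false v k) /\ (b -> u <> v).
suff IH b : size u = size v -> reflect (P b u v) (submask u v b).
  move=> suv; apply: (iffP (IH true suv)) => [[sub]|[sub neq]]; first by move/(_ isT).
  by split.
elim: u v b => [|a u IHu] [|c v] b //= => [_|[suv]].
  by case: b; [apply: ReflectF => -[_ /(_ isT)] | apply: ReflectT].
case: a c => [] [] /=.
- apply: (iffP (IHu v b suv)) => -[sub neq]; split.
  + by case=> [|k] //=; apply: sub.
  + by move=> bT [uv]; apply: neq uv.
  + by move=> k; apply: (sub k.+1).
  + by move=> bT uv; apply: neq => //; rewrite uv.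
- by apply: ReflectF => -[/(_ 0 isT)].
- apply: (iffP (IHu v false suv)) => -[sub _]; split=> //.
  + by case=> [|k] //=; apply: sub.
  + by move=> k; apply: (sub k.+1).
- apply: (iffP (IHu v b suv)) => -[sub neq]; split.
  + by case=> [|k] //=; apply: sub.
  + by move=> bT [uv]; apply: neq uv.
  + by move=> k; apply: (sub k.+1).
  + by move=> bT uv; apply: neq => //; rewrite uv.
Qed.

Definition minimal_vec r (S : seq bitseq) J :=
  has id J &&
  all (fun K => [==> has id K, all (fun v => dot v K ==> dot v J) S => K == J]) (vecs r).

Lemma minimal_vecP r S J :
  reflect (has id J /\ forall K, size K = r -> has id K ->
             {in S, forall v, dot v K -> dot v J} -> K = J)
    (minimal_vec r S J).
Proof.
apply: (iffP andP) => -[J0 minJ]; split=> //.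
  move=> K sK K0 KJ; have := allP minJ K.
  rewrite mem_vecs sK eqxx => /(_ isT) /implyP/(_ K0)/implyP KJ'.
  by apply/eqP/KJ'/allP=> v vS; apply/implyP; apply: KJ.
apply/allP=> K; rewrite mem_vecs => /eqP sK; apply/implyP=> K0; apply/implyP=> /allP KJ.
by apply/eqP/minJ => // v /KJ/implyP.
Qed.

Section CheckSound.
Variables (r : nat) (S : seq bitseq).
Hypothesis sizeS : forall v, v \in S -> size v = r.
Hypothesis unitS : forall k, k < r -> unit_vec r k \in S.
Hypothesis linkedS : forall k, 0 < k < r -> exists2 v, v \in S & crossing k v.

Definition survivors (T : seq bitseq) J :=
  [seq K <- vecs r | (has id K && submask K J true) && all (fun v => dot v K ==> dot v J) T].

Definition state_of T : state := [seq (J, survivors T J) | J <- [seq J <- vecs r | has id J]].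

Lemma state_of_nil : state_of [::] = start r.
Proof.
by apply: eq_map => J; rewrite /survivors; congr pair; apply: eq_filter => K; rewrite /= andbT.
Qed.

Lemma state_of_cons v T : state_of (v :: T) = refine v (state_of T).
Proof.
rewrite /refine /state_of -map_comp; apply: eq_map => J /=; case: ifP => dJ.
  by congr pair; apply: eq_filter => K; rewrite /= dJ implybT.
by congr pair; rewrite -filter_predI; apply: eq_filter => K; rewrite /= dJ implybF andbCA.
Qed.

(** A functional whose support lies in that of J is below J entry by entry, as the
    unit vectors belong to [S]; so it is among the competitors kept in a state. *)
Lemma survivors_nil T J : size J = r -> has id J -> {subset T <= S} ->
  survivors T J = [::] -> minimal_vec r S J.
Proof.
move=> sJ J0 TS /eqP; rewrite -[_ == _]negbK -has_filter => /hasPn noK.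
apply/minimal_vecP; split=> // K sK K0 KJ; apply: contraTeq isT => /eqP KneqJ.
have := noK K; rewrite mem_vecs sK eqxx => /(_ isT); rewrite K0 /=.
rewrite (introT (proper_submaskP _)) ?sK ?sJ //=; last first.
  split=> // k Kk; have kr : k < r.
    by rewrite -sK ltnNge; apply: contraTN Kk => /(nth_default false)->.
  by rewrite -(dot_unit J kr); apply: KJ; rewrite ?dot_unit //; apply: unitS.
by case/allPn=> v /TS Sv; rewrite negb_imply => /andP[/(KJ v Sv)->].
Qed.

Lemma nil_survivors T J : size J = r -> (forall v, v \in S -> 1 < count id v -> v \in T) ->
  minimal_vec r S J -> survivors T J = [::].
Proof.
move=> sJ ST /minimal_vecP[J0 minJ]; apply/eqP; rewrite -[_ == _]negbK -has_filter.
apply/hasPn=> K; rewrite mem_vecs => /eqP sK; apply/negP=> /andP[/andP[K0 /proper_submaskP]].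
rewrite sK sJ => /(_ erefl)[sub KJ] /allP le; case: KJ; apply: minJ => // v Sv dK.
have [v1|v1] := ltnP 1 (count id v); first by have := le v (ST v Sv v1); rewrite dK.
have [k kr vE] := light_vec (sizeS Sv) v1 dK.
by move: dK; rewrite vE !dot_unit //; apply: sub.
Qed.

Lemma settled_le T : {subset T <= S} -> settled (state_of T) <= count (minimal_vec r S) (vecs r).
Proof.
move=> TS; rewrite /settled count_map count_filter.
rewrite (@eq_in_count _ _
  (predI (minimal_vec r S) (fun J => nilp (survivors T J) && has id J))); last first.
  move=> J; rewrite mem_vecs => /eqP sJ /=; apply/idP/andP=> [nJ|[]//]; split=> //.
  case/andP: nJ => /nilP sn J0; exact: survivors_nil sn.
by apply: sub_count => J /andP[].
Qed.

Lemma settled_eq T : {subset T <= S} ->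
    (forall v, v \in S -> 1 < count id v -> v \in T) ->
  settled (state_of T) = count (minimal_vec r S) (vecs r).
Proof.
move=> TS ST; rewrite /settled count_map count_filter; apply: eq_in_count => J.
rewrite mem_vecs => /eqP sJ; apply/andP/idP => /= [[/nilP sn J0]|minJ].
  exact: survivors_nil sn.
by rewrite (nil_survivors sJ ST minJ); case/minimal_vecP: minJ.
Qed.

Lemma crossing_heavy k v : crossing k v -> 1 < count id v.
Proof.
case/andP=> vk vtake; rewrite -(cat_take_drop k v) count_cat.
have kv : k < size v by rewrite ltnNge; apply: contraTN vk => /(nth_default false)->.
rewrite (drop_nth false kv) /= vk; move: vtake; rewrite has_count; lia.
Qed.

Lemma linked_heavy L : (forall v, v \in S -> 1 < count id v -> v \in L) -> linked r L.
Proof.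
move=> SL; apply/allP=> k; rewrite mem_iota => kr; apply/hasP.
have [|v Sv kv] := linkedS (k := k); first by move: kr; lia.
by exists v => //; apply: SL (crossing_heavy kv).
Qed.

Lemma check_sound good rem T :
    check r good rem T (state_of T) -> {subset T <= S} ->
    (forall v, v \in S -> 1 < count id v -> v \in T ++ rem) ->
  17 <= count (minimal_vec r S) (vecs r) \/ good (count (minimal_vec r S) (vecs r)).
Proof.
elim: rem T => [|v rem IHrem] T chk TS ST; move: chk; rewrite /check -/check linked_heavy //=.
  case: ifP => [/leq_trans le17 _|_]; first by left; apply/le17/settled_le.
  by rewrite (settled_eq TS) => [|w Sw w1]; [right | rewrite -[T]cats0; apply: ST].
case: ifP => [/leq_trans le17 _|_]; first by left; apply/le17/settled_le.
case: ifP => // chk1 chk2.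
have [Sv|NSv] := boolP (v \in S).
  apply: (IHrem (v :: T)); rewrite ?state_of_cons // => w.
    by rewrite inE => /orP[/eqP->|/TS].
  by move=> Sw /(ST w Sw); rewrite !mem_cat !inE orbCA orbA.
apply: (IHrem T) => // w Sw /(ST w Sw); rewrite !mem_cat inE => /or3P[->//|/eqP wv|->].
  by rewrite -wv Sw in NSv.
by rewrite orbT.
Qed.

Lemma check_heavy good :
    check r good (heavy r) [::] (start r) ->
  17 <= count (minimal_vec r S) (vecs r) \/ good (count (minimal_vec r S) (vecs r)).
Proof.
rewrite -state_of_nil => /check_sound; apply=> // v Sv v1; apply/flatten_mapP.
exists (count id v); last by rewrite mem_filter mem_vecs (sizeS Sv) !eqxx.
rewrite mem_rev mem_iota v1 /=; have := count_size id v; rewrite (sizeS Sv); lia.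
Qed.

End CheckSound.

Theorem count_minimal_vec_bound r (S : seq bitseq) :
    0 < r <= 6 -> {in S, forall v, size v = r} ->
    (forall k, k < r -> unit_vec r k \in S) ->
    (forall k, 0 < k < r -> exists2 v, v \in S & crossing k v) ->
  17 <= count (minimal_vec r S) (vecs r) \/ allowed_count r (count (minimal_vec r S) (vecs r)).
Proof.
move=> r16 szS unitS lnkS; apply: check_heavy => //.
by apply: (allP check_passes); rewrite mem_iota.
Qed.

(** * Minimal words of indecomposable binary codes *)

Section BinaryCode.
Variables (E : finType) (C : pred {set E}).
Hypothesis C0 : C set0.
Hypothesis CD : forall A B, C A -> C B -> C (A :+: B).
Implicit Types (Z F : {set E}) (s : seq E) (b : bitseq).

Definition minimal_word Z := minset [pred F : {set E} | (F != set0) && C F] Z.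

(** [I] is an information set: words are determined by their trace on [I], and
    [B i] is the basis word with trace {i}. For a graph, [I] is the complement of
    a spanning tree and the [B i] are the fundamental cycles. *)
Definition systematic (I : {set E}) (B : E -> {set E}) :=
  (forall Z, C Z -> [disjoint Z & I] -> Z = set0) /\
  (forall i, i \in I -> C (B i) /\ B i :&: I = [set i]).

(** Take [I] minimal among the sets that meet every nonempty word: a word that
    meets [I] but not [I] minus i has trace {i}. *)
Lemma systematic_exists : exists I B, systematic I B.
Proof.
pose hits (I : {set E}) := [forall Z, (C Z && (Z != set0)) ==> ~~ [disjoint Z & I]].
have hitsT : hits setT.
  apply/forallP=> Z; apply/implyP=> /andP[_ /set0Pn[x xZ]].
  by apply/pred0Pn; exists x; rewrite /= xZ inE.
have [I /minsetP[hitI minI] _] := minset_exists hitsT.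
have I0 Z : C Z -> [disjoint Z & I] -> Z = set0.
  move=> CZ dZ; apply/eqP; apply: contraLR dZ => Z0.
  by have := forallP hitI Z; rewrite CZ Z0.
exists I, (fun i => odflt set0 [pick Z | C Z && (Z :&: I == [set i])]); split=> // i iI.
case: pickP => [Z /andP[CZ /eqP ZI] //|noZ].
have /forallPn[Z] : ~~ hits (I :\ i).
  apply/negP=> /minI/(_ (subsetDl _ _))/setP/(_ i).
  by rewrite !inE eqxx iI.
rewrite negb_imply negbK => /andP[/andP[CZ Z0] dZ].
have := noZ Z; rewrite CZ /= => /eqP[]; apply/setP=> k; rewrite !inE.
have [->|ki] := eqVneq k i; last first.
  apply: contraTF dZ => /andP[kZ kI]; apply/pred0Pn; exists k.
  by rewrite /= kZ !inE ki.
rewrite iI andbT; apply: contraNT Z0 => iZ; apply/eqP/I0 => //.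
apply/pred0P=> l /=; apply: contraTF dZ => /andP[lZ lI]; apply/pred0Pn; exists l.
by rewrite /= lZ !inE lI andbT; apply: contraNneq iZ => <-.
Qed.

Section Systematic.
Variables (I : {set E}) (B : E -> {set E}).
Hypothesis sysI : systematic I B.

Definition coords s e : bitseq := [seq e \in B i | i <- s].
Definition comb s b := [set e | dot (coords s e) b].

Lemma size_coords s e : size (coords s e) = size s.
Proof. exact: size_map. Qed.

Lemma mem_basis i j : i \in I -> j \in I -> (i \in B j) = (i == j).
Proof.
move=> iI jI; have [_ /setP/(_ i)] := sysI.2 j jI.
by rewrite !inE iI andbT.
Qed.

Lemma word_eq Z F : C Z -> C F -> {in I, Z =i F} -> Z = F.
Proof.
move=> CZ CF ZF; apply/eqP; rewrite -symdiff_eq0; apply/eqP/(sysI.1); first exact: CD.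
apply/pred0P=> i /=; apply/negP=> /andP[]; rewrite inE => iZF iI.
by move: iZF; rewrite ZF ?addbb.
Qed.

Lemma word_comb s b : {subset s <= I} -> C (comb s b).
Proof.
elim: s b => [|i s IHs] [|a b] sI;
  try by rewrite (_ : comb _ _ = set0) //; apply/setP=> e; rewrite !inE.
have CB : C (comb s b) by apply: IHs => j js; apply: sI; rewrite inE js orbT.
case: a.
  rewrite (_ : comb _ _ = B i :+: comb s b).
    by apply: CD => //; case: (sysI.2 i (sI i (mem_head _ _))).
  by apply/setP=> e; rewrite !inE (dot_cons (e \in B i) (coords s e) true b) andbT.
rewrite (_ : comb _ _ = comb s b) //.
by apply/setP=> e; rewrite !inE (dot_cons (e \in B i) (coords s e) false b) andbF.
Qed.

(** Pairing with a unit vector reads off an entry; the entry is 0, the default,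
    when [i] does not occur in [s]. *)
Lemma dot_eq_index (s : seq E) b i : uniq s -> size b = size s ->
  dot [seq i == j | j <- s] b = nth false b (index i s).
Proof.
elim: s b => [|j s IHs] [|a b] //; rewrite cons_uniq => /andP[js us] [sb].
rewrite map_cons dot_cons IHs //= [j == i]eq_sym.
have [ij|_] //= := eqVneq i j; rewrite nth_default ?addbF // sb leqNgt index_mem ij.
exact: js.
Qed.

Section Prefix.
Variable s : seq E.
Hypotheses (us : uniq s) (sI : {subset s <= I}).

Lemma mem_comb b i : size b = size s -> i \in I -> (i \in comb s b) = nth false b (index i s).
Proof.
move=> sb iI; rewrite inE -dot_eq_index //; congr dot.
by apply/eq_in_map => j js; rewrite mem_basis // sI.
Qed.

(** A word whose trace on [I] lies in [s] is the combination of basis words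
    prescribed by its trace. *)
Lemma comb_trace Z : C Z -> {in I, forall i, i \in Z -> i \in s} ->
  Z = comb s [seq i \in Z | i <- s].
Proof.
move=> CZ Zs; apply: word_eq => // [|i iI]; first exact: word_comb.
rewrite mem_comb ?size_map //; have [is_|is_] := boolP (i \in s).
  by rewrite (nth_map i) ?index_mem // nth_index.
rewrite nth_default; last by rewrite size_map leqNgt index_mem.
by apply/negbTE; apply: contra is_; apply: Zs.
Qed.

Lemma comb_inj : {in [pred b | size b == size s] &, injective (comb s)}.
Proof.
move=> b c; rewrite !inE => /eqP sb /eqP sc bc.
apply: (@eq_from_nth _ false) => [|k]; rewrite ?sb ?sc // => ks.
case: s us sI sb sc ks bc => // i0 s' us' sI' sb sc ks bc; pose i := nth i0 (i0 :: s') k.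
have /setP/(_ i) := bc; have iI : i \in I by apply/sI'/mem_nth.
have ind d : size d = size (i0 :: s') -> (i \in comb (i0 :: s') d) = nth false d k.
  move=> sd; rewrite inE -[k in RHS](index_uniq i0 ks us') -dot_eq_index //; congr dot.
  by apply/eq_in_map => j js; rewrite mem_basis // sI'.
by rewrite !ind.
Qed.

Lemma comb_eq0 b : size b = size s -> (comb s b == set0) = ~~ has id b.
Proof.
move=> sb; have nil0 : comb s (nseq (size s) false) = set0.
  apply: word_eq => // [|i iI]; first exact: word_comb.
  by rewrite mem_comb ?size_nseq // nth_nseq if_same inE.
rewrite -nil0 (inj_in_eq comb_inj) ?inE ?size_nseq ?sb //.
apply/eqP/hasPn => [-> x /nseqP[->] //|b0].
apply: (@eq_from_nth _ false) => [|k kb]; first by rewrite size_nseq.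
rewrite nth_nseq -sb kb; apply/negbTE/b0; exact: mem_nth.
Qed.

(** The column vectors of a generator matrix with rows [B i], for i in [s]. *)
Definition code_vectors := [seq coords s e | e <- enum E].

(** A word inside [comb s b] has its trace inside [s], so it is itself a
    combination of the chosen basis words. Hence minimality among these
    combinations is minimality in the whole code. *)
Lemma minimal_word_comb b : size b = size s ->
  minimal_vec (size s) code_vectors b -> minimal_word (comb s b).
Proof.
move=> sb /minimal_vecP[b0 minb]; apply/minsetP; split=> [|F /andP[F0 CF] Fb].
  by rewrite /= comb_eq0 // b0 word_comb.
have FE : F = comb s [seq i \in F | i <- s].
  apply: comb_trace => // i iI /(subsetP Fb); rewrite mem_comb //.
  by apply: contraLR => is_; rewrite nth_default // sb leqNgt index_mem.
rewrite FE; congr comb; apply: minb; rewrite ?size_map //.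
  by move: F0; rewrite FE comb_eq0 ?size_map // negbK -FE.
move=> _ /mapP[e _ ->] eF; have: e \in comb s b by apply: (subsetP Fb); rewrite FE inE.
by rewrite inE.
Qed.

Lemma minimal_vec_trace Z : {subset I <= s} -> minimal_word Z ->
  exists b, [/\ size b = size s, minimal_vec (size s) code_vectors b & Z = comb s b].
Proof.
move=> Is /minsetP[/andP[Z0 CZ] minZ]; pose b := [seq i \in Z | i <- s].
have ZE : Z = comb s b by apply: comb_trace => // i iI _; apply: Is.
have sb : size b = size s by rewrite size_map.
exists b; split=> //; apply/minimal_vecP; split=> [|K sK K0 Kb].
  by move: Z0; rewrite ZE comb_eq0 // negbK.
apply: comb_inj; rewrite ?inE ?sK ?sb // -ZE; apply: minZ.
  by rewrite /= comb_eq0 // K0 word_comb.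
apply/subsetP=> e; rewrite inE => dK; rewrite ZE inE; apply: Kb dK.
by apply/mapP; exists e; rewrite // mem_enum.
Qed.

Lemma count_minimal_vec_le :
  count (minimal_vec (size s) code_vectors) (vecs (size s)) <= #|[set Z | minimal_word Z]|.
Proof.
rewrite -size_filter -(size_map (comb s)); set l := map _ _.
have ul : uniq l.
  rewrite map_inj_in_uniq ?filter_uniq ?vecs_uniq // => b c.
  by rewrite !mem_filter !mem_vecs => /andP[_ sb] /andP[_ sc]; apply: comb_inj.
rewrite -(card_uniqP ul); apply/subset_leq_card/subsetP=> Z /mapP[b].
rewrite mem_filter mem_vecs => /andP[mb /eqP sb] ->.
by rewrite inE; apply: minimal_word_comb.
Qed.

Lemma count_minimal_vec : {subset I <= s} ->
  count (minimal_vec (size s) code_vectors) (vecs (size s)) = #|[set Z | minimal_word Z]|.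
Proof.
move=> Is; apply/eqP; rewrite eqn_leq count_minimal_vec_le /=.
rewrite -size_filter -(size_map (comb s)); apply: leq_trans (card_size _).
apply/subset_leq_card/subsetP=> Z; rewrite inE => /(minimal_vec_trace Is)[b [sb mb ->]].
by apply: map_f; rewrite mem_filter mb mem_vecs sb eqxx.
Qed.

Lemma unit_code_vector k : k < size s -> unit_vec (size s) k \in code_vectors.
Proof.
move=> ks; have x0 : E by case: (s) ks.
apply/mapP; exists (nth x0 s k); first by rewrite mem_enum.
apply: (@eq_from_nth _ false); rewrite size_mkseq ?size_map // => j js.
by rewrite nth_mkseq // (nth_map x0) // mem_basis ?sI ?mem_nth // nth_uniq.
Qed.

End Prefix.

Hypothesis indecomposable : forall (E1 : {set E}) e1 e2, e1 \in E1 -> e2 \notin E1 ->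
  exists2 Z, C Z & ~~ C (Z :&: E1).

(** The elements of [I] are chosen greedily. If no coordinate linked the chosen
    elements to the others, the coordinates covered by the chosen basis words
    would split the code: the trace of a word on them would be a combination of
    chosen basis words, hence a word. *)
Lemma linked_order n : 0 < n <= #|I| ->
  exists s, [/\ uniq s, size s = n, {subset s <= I}
              & forall k, 0 < k < n -> exists e, crossing k (coords s e)].
Proof.
elim: n => // -[_|n IHn] /andP[_ nI].
  have /card_gt0P[i iI] := nI.
  by exists [:: i]; split=> [|||[|k]] // j; rewrite inE => /eqP->.
have [|s [us ss sI lnk]] := IHn; first exact: ltnW.
pose E1 := [set e | has id (coords s e)].
have inE1 e : (e \in E1) = has (fun i => e \in B i) s by rewrite inE has_map.
suff [j [e [jI js eE1 eB]]] : exists j e, [/\ j \in I, j \notin s, e \in E1 & e \in B j].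
  exists (rcons s j); split=> [||i|k].
  - by rewrite rcons_uniq js.
  - by rewrite size_rcons ss.
  - by rewrite mem_rcons inE => /orP[/eqP->|/sI].
  rewrite -ss ltnS => /andP[k0 ks]; have [kss|kss] := ltnP k (size s).
    have [|e' ce'] := lnk k; first by rewrite k0 -ss.
    exists e'; move: ce'; rewrite /crossing /coords map_rcons nth_rcons size_map kss.
    by rewrite -cats1 takel_cat // size_map ltnW.
  have kE : k = size s by lia.
  exists e; rewrite /crossing /coords map_rcons nth_rcons size_map kE ltnn eqxx eB.
  by rewrite -cats1 take_cat size_map ltnn subnn take0 cats0; move: eE1; rewrite inE.
have [j jI js] : exists2 j, j \in I & j \notin s.
  apply/subsetPn; apply: contraL nI => /subset_leq_card; rewrite (card_uniqP us) ss.
  by rewrite -ltnNge.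
pose bad := [exists j, exists e, [&& j \in I, j \notin s, e \in E1 & e \in B j]].
have [/existsP[k /existsP[e /and4P[]]]|nobad] := boolP bad; first by exists k, e.
have sep k e : k \in I -> k \notin s -> e \in E1 -> e \notin B k.
  move=> kI ks eE1; apply: contra nobad => eB; apply/existsP; exists k; apply/existsP; exists e.
  by rewrite kI ks eE1.
have [i is_] : exists i, i \in s by case: (s) ss => // i s' _; exists i; rewrite mem_head.
have iE1 : i \in E1 by rewrite inE1; apply/hasP; exists i; rewrite // mem_basis ?sI.
have jE1 : j \notin E1 by apply/negP=> /(sep j j jI js); rewrite mem_basis ?eqxx.
have [Z CZ /negP[]] := indecomposable iE1 jE1.
pose Z' := comb s [seq i \in Z | i <- s]; have CZ' : C Z' by apply: word_comb.
pose t := [seq i <- enum I | i \notin s].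
have ut : uniq t by rewrite filter_uniq ?enum_uniq.
have tI : {subset t <= I} by move=> k; rewrite mem_filter mem_enum => /andP[].
have YE : Z :+: Z' = comb t [seq i \in Z :+: Z' | i <- t].
  apply: comb_trace => //; first exact: CD.
  move=> k kI; rewrite mem_filter mem_enum kI andbT; apply: contraL => ks.
  rewrite inE mem_comb ?size_map // (nth_map k) ?index_mem // nth_index // addbb //.
suff -> : Z :&: E1 = Z' by [].
apply/setP=> e; rewrite inE; have [eE1|eE1] := boolP (e \in E1); last first.
  rewrite andbF; apply/esym/negbTE; apply: contra eE1; rewrite !inE; apply: contraLR.
  move=> /hasPn c0; suff -> : coords s e = nseq (size s) false by rewrite dot0.
  apply: (@eq_from_nth _ false); rewrite size_coords ?size_nseq // => k ks.
  by rewrite nth_nseq ks; apply/negbTE/c0/mem_nth; rewrite size_coords.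
have : e \notin Z :+: Z'.
  rewrite YE inE (_ : coords t e = nseq (size t) false) ?dot0 //.
  apply: (@eq_from_nth _ false); rewrite size_coords ?size_nseq // => k kt.
  rewrite nth_nseq kt (nth_map e) //; apply/negbTE; have := mem_nth e kt.
  by rewrite mem_filter mem_enum => /andP[ks kI]; apply: sep.
by rewrite inE andbT; case: (e \in Z) (e \in Z') => [] [].
Qed.

Lemma num_minimal_words_systematic :
  #|[set Z | minimal_word Z]| \notin [:: 2; 4; 5; 8; 9; 16].
Proof.
have [I0|Igt0] := posnP #|I|.
  rewrite (_ : [set _ | _] = set0) ?cards0 //; apply/setP=> Z; rewrite !inE.
  apply/negP=> /minsetP[/andP[/eqP Z0 CZ] _]; apply: Z0; apply: sysI.1 => //.
  by rewrite (cards0_eq I0) -setI_eq0 setI0.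
pose r := minn 6 #|I|.
have [|s [us ss sI lnk]] := @linked_order r; first by rewrite /r; lia.
have szv v : v \in code_vectors s -> size v = r.
  by case/mapP=> e _ ->; rewrite size_coords.
have unitv k : k < r -> unit_vec r k \in code_vectors s.
  by rewrite -ss; apply: unit_code_vector.
have lnkv k : 0 < k < r -> exists2 v, v \in code_vectors s & crossing k v.
  by case/lnk=> e ce; exists (coords s e) => //; apply/mapP; exists e; rewrite ?mem_enum.
have r16 : 0 < r <= 6 by rewrite /r; lia.
have := count_minimal_vec_bound r16 szv unitv lnkv.
have := count_minimal_vec_le us sI; rewrite ss.
have [r6|rn6] := eqVneq r 6.
  set N := #|_|; set c := count _ _ => cN; rewrite /allowed_count r6 eqxx /=.
  move=> c17; have {c17 cN}: 17 <= N by apply: leq_trans cN; case: c17 => // /andP[].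
  by rewrite !inE; lia.
have Is : {subset I <= s}.
  have: #|I| <= size s by rewrite ss; move: rn6; rewrite /r; lia.
  move=> leI; have sIs : [set i in s] \subset I by apply/subsetP=> i; rewrite inE; apply: sI.
  have /eqP <- : [set i in s] == I.
    by rewrite eqEcard sIs cardsE (card_uniqP us).
  by move=> i; rewrite inE.
rewrite -(count_minimal_vec us sI Is) ss => _ [|/andP[]//]; rewrite !inE; lia.
Qed.

End Systematic.

(** Connected binary matroids, in fact, miss the same six numbers of circuits. *)
Theorem num_minimal_words :
    (forall (E1 : {set E}) e1 e2, e1 \in E1 -> e2 \notin E1 -> exists2 Z, C Z & ~~ C (Z :&: E1)) ->
  #|[set Z | minimal_word Z]| \notin [:: 2; 4; 5; 8; 9; 16].
Proof.
by have [I [B sysI]] := systematic_exists; apply: num_minimal_words_systematic sysI.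
Qed.

End BinaryCode.

Lemma num_cycles_inseparable (G : mgraph) :
  inseparable G -> num_cycles G \notin [:: 2; 4; 5; 8; 9; 16].
Proof.
move=> insG; rewrite num_cyclesE.
apply: (@num_minimal_words _ (fun Z : {set edge G} => boundary Z == set0)).
- by rewrite boundary0.
- by move=> A B /eqP bA /eqP bB; rewrite boundary_symdiff bA bB symdiffv.
move=> E1 e1 e2 e1E e2E.
by have [Z bZ bZE] := cycle_space_indecomposable insG e1E e2E; exists Z; rewrite ?bZ.
Qed.

(** * Joining a new vertex to two marked vertices *)

Section MoreJoins.
Variable G : mgraph.
Implicit Types (T : {set vertex G}) (Z F : {set edge G}).

(** Adding an even subset modulo 2 to a join removes it, leaving a smaller join. *)
Lemma min_join_acyclic T Z F : T != set0 -> min_join T Z ->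
  F \subset Z -> boundary F = set0 -> F = set0.
Proof.
move=> T0 /min_joinP[Z0 bZ minZ] FZ bF.
have bZF : boundary (Z :+: F) = T by rewrite boundary_symdiff bZ bF symdiff0.
have ZF : Z :+: F = Z.
  apply: minZ => //; first exact: symdiff_sub.
  by apply: contraNneq T0 => ZF0; rewrite -bZF ZF0 boundary0.
apply/setP=> e; have /setP/(_ e) := ZF; rewrite !inE.
by case: (e \in Z) (e \in F) => [] [].
Qed.

End MoreJoins.

Section AddVertex.
Variables (G : mgraph) (s t : vertex G) (a b : nat).
Hypothesis st : s != t.
Let E' := (edge G + ('I_a + 'I_b))%type.

Definition bundle_ends (e : E') : {set option (vertex G)} :=
  match e with
  | inl e => Some @: ends e
  | inr (inl _) => [set Some s; None]
  | inr (inr _) => [set Some t; None]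
  end.

Lemma card_bundle_ends e : #|bundle_ends e| = 2.
Proof.
case: e => [e|[i|j]] /=; rewrite ?cards2 // card_imset ?card_ends //.
exact: Some_inj.
Qed.

Definition bundle := MGraph card_bundle_ends.

(** Edge sets of the new graph are handled as triples of edge sets. *)
Definition glue (w : {set edge G} * ({set 'I_a} * {set 'I_b})) : {set edge bundle} :=
  [set e : E' | match e with
                | inl e => e \in w.1
                | inr (inl i) => i \in w.2.1
                | inr (inr j) => j \in w.2.2
                end].

Lemma glue_inj : injective glue.
Proof.
move=> [Z [A B]] [Z' [A' B']] /setP eqW; congr (_, (_, _)); apply/setP=> x.
- by have := eqW (inl x); rewrite !inE.
- by have := eqW (inr (inl x)); rewrite !inE.
by have := eqW (inr (inr x)); rewrite !inE.
Qed.

Lemma glue_surj W : exists w, W = glue w.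
Proof.
exists ([set e | inl e \in W], ([set i | inr (inl i) \in W], [set j | inr (inr j) \in W])).
by apply/setP=> -[e|[i|j]]; rewrite !inE.
Qed.

Lemma glue_sub Z A B Z' A' B' :
  (glue (Z, (A, B)) \subset glue (Z', (A', B'))) = [&& Z \subset Z', A \subset A' & B \subset B'].
Proof.
apply/subsetP/and3P => [sub|[/subsetP sZ /subsetP sA /subsetP sB] [e|[i|j]]]; rewrite ?inE; last first.
- exact: sB.
- exact: sA.
- exact: sZ.
split; apply/subsetP=> x.
- by have := sub (inl x); rewrite !inE.
- by have := sub (inr (inl x)); rewrite !inE.
by have := sub (inr (inr x)); rewrite !inE.
Qed.

Lemma glue_eq0 Z A B : (glue (Z, (A, B)) == set0) = [&& Z == set0, A == set0 & B == set0].
Proof.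
have -> : set0 = glue (set0, (set0, set0)) by apply/setP=> -[e|[i|j]]; rewrite !inE.
by rewrite (inj_eq glue_inj) !xpair_eqE.
Qed.

(** Evenness at the new vertex equates the two parities; when they are odd, the
    new edges contribute s and t to the boundary. *)
Lemma boundary_glue (T : {set vertex G}) Z A B :
  (boundary (glue (Z, (A, B))) == Some @: T) =
  (odd #|A| == odd #|B|) && (boundary Z == if odd #|A| then T :+: [set s; t] else T).
Proof.
have bN : ((None : vertex bundle) \in boundary (glue (Z, (A, B)))) = odd #|A| (+) odd #|B|.
  rewrite boundaryE big_sumType big_sumType /= big1 => [|e].
    rewrite addFb !odd_card; congr (_ (+) _); apply: eq_big => x //; rewrite ?inE //.
  by case/imsetP.
have bS x : ((Some x : vertex bundle) \in boundary (glue (Z, (A, B)))) =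
    (x \in boundary Z) (+) (((x == s) && odd #|A|) (+) ((x == t) && odd #|B|)).
  rewrite boundaryE big_sumType big_sumType /= boundaryE; congr (_ (+) (_ (+) _)).
  - by apply: eq_big => e; rewrite ?inE ?mem_imset //; apply: Some_inj.
  - rewrite odd_card; case: (eqVneq x s) => [->|xs] /=.
      by apply: eq_big => i; rewrite !inE ?eqxx.
    by rewrite big_pred0 // => i; rewrite !inE orbF; apply/negbTE.
  rewrite odd_card; case: (eqVneq x t) => [->|xt] /=.
    by apply: eq_big => i; rewrite !inE ?eqxx.
  by rewrite big_pred0 // => i; rewrite !inE orbF; apply/negbTE.
have memS x : (Some x \in Some @: T) = (x \in T) by rewrite mem_imset //; apply: Some_inj.
apply/eqP/andP=> [eqW|[/eqP oAB /eqP bZ]].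
  have oAB : odd #|A| = odd #|B|.
    have /setP/(_ None) := eqW; rewrite bN.
    rewrite (_ : (None \in _) = false); last by apply/negP=> /imsetP[].
    by case: (odd #|A|) (odd #|B|) => [] [].
  split; first exact/eqP.
  apply/eqP/setP=> x; have /setP/(_ (Some x)) := eqW; rewrite bS memS -oAB.
  case: (odd _); rewrite ?andbT ?andbF ?addbF // !inE => <-.
  have [->|xs] := eqVneq x s; first by rewrite (negPf st); case: (odd (deg Z s)).
  by case: (odd (deg Z x)); case: (x == t).
apply/setP=> -[x|]; last first.
  by rewrite bN oAB addbb; apply/esym/negP=> /imsetP[].
rewrite bS memS -oAB bZ; case: (odd _); rewrite ?andbT ?andbF ?addbF // !inE.
have [->|xs] := eqVneq x s; first by rewrite (negPf st); case: (s \in T).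
by case: (x \in T); case: (x == t).
Qed.

Lemma card_pair (X : finType) (A : {set X}) :
  1 < #|A| -> exists2 D : {set X}, D \subset A & #|D| = 2.
Proof.
case/card_gt1P=> x [y [xA yA xy]]; exists [set x; y]; last by rewrite cards2 xy.
by rewrite subUset !sub1set xA.
Qed.

(** Two parallel new edges already form a circuit, so apart from these pairs a
    circuit uses at most one edge of each bundle; if it uses one of each, the
    rest is a path from s to t. *)
Lemma circuit_glue Z A B : circuit (glue (Z, (A, B))) =
  [|| [&& circuit Z, A == set0 & B == set0],
      [&& Z == set0, #|A| == 2 & B == set0],
      [&& Z == set0, A == set0 & #|B| == 2]
    | [&& min_join [set s; t] Z, #|A| == 1 & #|B| == 1]].
Proof.
have st0 : [set s; t] != set0 by apply/set0Pn; exists s; rewrite !inE eqxx.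
have even0 := imset0 (@Some (vertex G)).
have bd0 Z' A' B' : (boundary (glue (Z', (A', B'))) == set0) =
    (odd #|A'| == odd #|B'|) && (boundary Z' == if odd #|A'| then [set s; t] else set0).
  rewrite -even0 boundary_glue; case: ifP => // _.
  by rewrite (_ : set0 :+: _ = [set s; t]) //; apply/setP=> x; rewrite !inE.
apply/idP/idP => [/min_joinP[W0 bW minW]|].
  have pick (Z' : {set edge G}) (A' : {set 'I_a}) (B' : {set 'I_b}) :
      Z' \subset Z -> A' \subset A -> B' \subset B ->
      glue (Z', (A', B')) != set0 -> boundary (glue (Z', (A', B'))) == set0 ->
    [/\ Z' = Z, A' = A & B' = B].
    move=> sZ sA sB W0' /eqP bW'.
    have sub : glue (Z', (A', B')) \subset glue (Z, (A, B)) by rewrite glue_sub sZ sA.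
    by have [-> -> ->] := glue_inj (minW _ sub W0' bW').
  have [A1|A1] := ltnP 1 #|A|.
    have [D DA D2] := card_pair A1.
    have [] := pick set0 D set0 (sub0set _) DA (sub0set _).
    - by rewrite glue_eq0 -!cards_eq0 D2 andbF.
    - by rewrite bd0 D2 ?cards0 boundary0 !eqxx.
    by move=> <- <- <-; rewrite D2 !eqxx /= orbT.
  have [B1|B1] := ltnP 1 #|B|.
    have [D DB D2] := card_pair B1.
    have [] := pick set0 set0 D (sub0set _) (sub0set _) DB.
    - by rewrite glue_eq0 -!cards_eq0 D2 !andbF.
    - by rewrite bd0 D2 ?cards0 boundary0 !eqxx.
    by move=> <- <- <-; rewrite D2 !eqxx !orbT.
  have /eqP := bW; rewrite bd0 => /andP[/eqP oAB /eqP bZ].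
  have [A0|An0] := eqVneq #|A| 0.
    have B0 : #|B| = 0 by move: oAB; rewrite A0; case: #|B| B1 => [|[|]].
    apply/orP; left; rewrite -!cards_eq0 A0 B0 !andbT.
    move: bZ; rewrite A0 /= => bZ; apply/min_joinP; split=> // [|F FZ F0 bF].
      by apply: contraNneq W0 => ->; rewrite glue_eq0 eqxx -!cards_eq0 A0 B0.
    have [] := pick F A B FZ (subxx _) (subxx _) => //.
    - by rewrite glue_eq0 (negPf F0).
    - by rewrite bd0 A0 B0 bF !eqxx.
  have A1' : #|A| = 1 by lia.
  have B1' : #|B| = 1 by move: oAB; rewrite A1'; case: #|B| B1 => [|[|]].
  rewrite A1' B1' !eqxx /= !andbT !orbA; apply/orP; right; apply/min_joinP.
  move: bZ; rewrite A1' /= => bZ; split=> //.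
    by apply: contraNneq st0 => Z0; rewrite -bZ Z0 boundary0.
  move=> F FZ F0 bF.
  have [] := pick F A B FZ (subxx _) (subxx _) => //.
  - by rewrite glue_eq0 (negPf F0).
  - by rewrite bd0 A1' B1' bF !eqxx.
have sub0 (X : finType) (A' : {set X}) : A' \subset set0 -> A' = set0.
  by rewrite subset0 => /eqP.
case/or4P => /and3P[].
- move=> /min_joinP[Z0 bZ minZ] /eqP-> /eqP->; apply/min_joinP; split.
  + by rewrite glue_eq0 (negPf Z0).
  + by apply/eqP; rewrite bd0 !cards0 bZ /= !eqxx.
  move=> W; have [[Z' [A' B']] ->] := glue_surj W; rewrite glue_sub => /and3P[sZ /sub0-> /sub0->].
  by rewrite glue_eq0 !eqxx !andbT => Z'0 /eqP; rewrite bd0 !cards0 /= => /eqP bZ'; rewrite (minZ Z').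
- move=> /eqP-> /eqP A2 /eqP->; apply/min_joinP; split.
  + by rewrite glue_eq0 -!cards_eq0 A2 andbF.
  + by apply/eqP; rewrite bd0 !cards0 A2 boundary0 !eqxx.
  move=> W; have [[Z' [A' B']] ->] := glue_surj W; rewrite glue_sub => /and3P[/sub0-> sA /sub0->].
  rewrite glue_eq0 !eqxx andbT /= -cards_eq0 => A0 /eqP; rewrite bd0 !cards0 => /andP[oA _].
  suff -> : A' = A by [].
  apply/eqP; rewrite eqEcard sA A2; move: oA A0; case: #|A'| => [|[|]] //.
- move=> /eqP-> /eqP-> /eqP B2; apply/min_joinP; split.
  + by rewrite glue_eq0 -!cards_eq0 B2 !andbF.
  + by apply/eqP; rewrite bd0 !cards0 B2 boundary0 !eqxx.
  move=> W; have [[Z' [A' B']] ->] := glue_surj W; rewrite glue_sub => /and3P[/sub0-> /sub0-> sB].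
  rewrite glue_eq0 !eqxx /= -cards_eq0 => B0 /eqP; rewrite bd0 !cards0 => /andP[oB _].
  suff -> : B' = B by [].
  apply/eqP; rewrite eqEcard sB B2; move: oB B0; case: #|B'| => [|[|]] //.
move=> mZ /eqP A1 /eqP B1; have /min_joinP[Z0 bZ minZ] := mZ; apply/min_joinP; split.
- by rewrite glue_eq0 (negPf Z0).
- by apply/eqP; rewrite bd0 A1 B1 bZ !eqxx.
move=> W; have [[Z' [A' B']] ->] := glue_surj W; rewrite glue_sub => /and3P[sZ sA sB].
move=> W0 /eqP; rewrite bd0 => /andP[/eqP oAB /eqP bZ'].
have [A0|An0] := eqVneq #|A'| 0.
  have B0 : #|B'| = 0.
    by move: oAB (subset_leq_card sB); rewrite A0 B1; case: #|B'| => [|[|]].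
  move: W0; rewrite A0 /= in bZ'; rewrite (min_join_acyclic st0 mZ sZ bZ').
  by rewrite (cards0_eq A0) (cards0_eq B0) glue_eq0 !eqxx.
have A1' : #|A'| = 1 by have := subset_leq_card sA; rewrite A1; lia.
have B1' : #|B'| = 1.
  by move: oAB (subset_leq_card sB); rewrite A1' B1; case: #|B'| => [|[|]].
rewrite A1' /= in bZ'; rewrite (minZ Z') //; last first.
  by apply: contraNneq st0 => Z'0; rewrite -bZ' Z'0 boundary0.
have -> : A' = A by apply/eqP; rewrite eqEcard sA A1 A1'.
by have -> : B' = B by apply/eqP; rewrite eqEcard sB B1 B1'.
Qed.

(** Two parallel new edges could be dropped from a join; and if one edge of each
    bundle is used, they form a path by themselves. *)
Lemma join_glue (Z : {set edge G}) (A : {set 'I_a}) (B : {set 'I_b}) :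
  @min_join bundle [set Some s; Some t] (glue (Z, (A, B))) =
  [&& min_join [set s; t] Z, A == set0 & B == set0] || [&& Z == set0, #|A| == 1 & #|B| == 1].
Proof.
have st0 : [set s; t] != set0 by apply/set0Pn; exists s; rewrite !inE eqxx.
have imst : [set Some s; Some t] = Some @: [set s; t] by rewrite imsetU !imset_set1.
have bdst Z' A' B' : (boundary (glue (Z', (A', B'))) == [set Some s; Some t]) =
    (odd #|A'| == odd #|B'|) && (boundary Z' == if odd #|A'| then set0 else [set s; t]).
  by rewrite imst boundary_glue symdiffv.
have glue0 Z' A' B' :
    boundary (glue (Z', (A', B'))) == [set Some s; Some t] -> glue (Z', (A', B')) != set0.
  move/eqP=> bW; apply/eqP=> W0; move: bW; rewrite W0 boundary0 => /setP/(_ (Some s)).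
  by rewrite !inE eqxx.
apply/idP/idP => [/min_joinP[W0 bW minW]|].
  have pick (Z' : {set edge G}) (A' : {set 'I_a}) (B' : {set 'I_b}) :
      Z' \subset Z -> A' \subset A -> B' \subset B ->
      boundary (glue (Z', (A', B'))) == [set Some s; Some t] ->
    [/\ Z' = Z, A' = A & B' = B].
    move=> sZ sA sB bW'.
    have sub : glue (Z', (A', B')) \subset glue (Z, (A, B)) by rewrite glue_sub sZ sA.
    by have [-> -> ->] := glue_inj (minW _ sub (glue0 _ _ _ bW') (eqP bW')).
  have /eqP := bW; rewrite bdst => /andP[/eqP oAB /eqP bZ].
  have odd_del (X : finType) (A' D : {set X}) : D \subset A' -> #|D| = 2 -> odd #|A' :\: D| = odd #|A'|.
    by move=> DA D2; rewrite -(cardsID D A') oddD (setIidPr DA) D2.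
  have DA0 (X : finType) (A' D : {set X}) : D \subset A' -> #|D| = 2 -> A' :\: D <> A'.
    move=> DA D2 /(congr1 (fun X : {set _} => #|X|)); rewrite -(cardsID D A') (setIidPr DA) D2; lia.
  have [A1|A1] := ltnP 1 #|A|.
    have [D DA D2] := card_pair A1.
    have [||||_ /(DA0 _ _ _ DA D2)//] := pick Z (A :\: D) B; rewrite ?subsetDl // bdst odd_del //.
    by rewrite oAB eqxx bZ oAB /=.
  have [B1|B1] := ltnP 1 #|B|.
    have [D DB D2] := card_pair B1.
    have [||||_ _ /(DA0 _ _ _ DB D2)//] := pick Z A (B :\: D); rewrite ?subsetDl // bdst odd_del //.
    by rewrite oAB eqxx bZ oAB /=.
  have [A0|An0] := eqVneq #|A| 0.
    have B0 : #|B| = 0 by move: oAB; rewrite A0; case: #|B| B1 => [|[|]].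
    move: bZ; rewrite A0 /= => bZ; apply/orP; left.
    rewrite -!cards_eq0 A0 B0 !andbT; apply/min_joinP; split=> //.
      by apply: contraNneq st0 => Z0; rewrite -bZ Z0 boundary0.
    move=> F FZ F0 bF.
    by have [] := pick F A B; rewrite // bdst A0 B0 bF !eqxx.
  have A1' : #|A| = 1 by lia.
  have B1' : #|B| = 1 by move: oAB; rewrite A1'; case: #|B| B1 => [|[|]].
  apply/orP; right; rewrite A1' B1' !andbT.
  have [||||<-] := pick set0 A B; rewrite ?sub0set // bdst A1' B1' boundary0 !eqxx //.
case/orP=> /and3P[].
  move=> /min_joinP[Z0 bZ minZ] /eqP-> /eqP->; apply/min_joinP; split.
  - by rewrite glue_eq0 (negPf Z0).
  - by apply/eqP; rewrite bdst !cards0 bZ !eqxx.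
  move=> W; have [[Z' [A' B']] ->] := glue_surj W; rewrite glue_sub !subset0.
  move=> /and3P[sZ /eqP-> /eqP->].
  by rewrite glue_eq0 !eqxx !andbT => Z'0 /eqP; rewrite bdst !cards0 /= => /eqP bZ'; rewrite (minZ Z').
move=> /eqP-> /eqP A1 /eqP B1.
have bW : boundary (glue (set0, (A, B))) == [set Some s; Some t].
  by rewrite bdst A1 B1 boundary0 !eqxx.
apply/min_joinP; split; [exact: glue0|exact/eqP|] => W.
have [[Z' [A' B']] ->] := glue_surj W; rewrite glue_sub subset0 => /and3P[/eqP-> sA sB] W0 /eqP.
rewrite bdst boundary0; have [A0|An0] := eqVneq #|A'| 0.
  by rewrite A0 /= [set0 == _]eq_sym (negPf st0) andbF.
have A1' : #|A'| = 1 by have := subset_leq_card sA; rewrite A1; lia.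
rewrite A1' => /andP[/eqP oB _].
have B1' : #|B'| = 1 by move: oB (subset_leq_card sB); rewrite B1; case: #|B'| => [|[|]].
have -> : A' = A by apply/eqP; rewrite eqEcard sA A1 A1'.
by have -> : B' = B by apply/eqP; rewrite eqEcard sB B1 B1'.
Qed.

Lemma card_glue (P : pred {set edge bundle}) : #|[set W | P W]| = #|[set w | P (glue w)]|.
Proof.
rewrite -(card_imset _ glue_inj); apply: eq_card => W; rewrite inE; apply/idP/imsetP.
  by have [w ->] := glue_surj W => Pw; exists w; rewrite ?inE.
by case=> w; rewrite inE => Pw ->.
Qed.

Lemma card_disjointU (X : finType) (A B : {set X}) :
  (forall x, x \in A -> x \notin B) -> #|A :|: B| = #|A| + #|B|.
Proof.
move=> AB; apply/eqP; rewrite -cardsUI -[X in X == _]addn0 eqn_add2l eq_sym cards_eq0.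
by apply/eqP/setP=> x; rewrite !inE; apply/negbTE/negP=> /andP[/AB/negbTE->].
Qed.

Lemma card_circuits_bundle : #|[set W : {set edge bundle} | circuit W]| =
  #|[set Z : {set edge G} | circuit Z]| + 'C(a, 2) + 'C(b, 2)
  + #|[set Z : {set edge G} | min_join [set s; t] Z]| * (a * b).
Proof.
rewrite card_glue; set cG := [set Z | circuit Z]; set jG := [set Z | min_join _ Z].
pose dr n k := [set A : {set 'I_n} | #|A| == k].
have cdr n k : #|dr n k| = 'C(n, k) by rewrite card_draws card_ord.
rewrite (_ : [set w | _] = setX cG (setX [set set0] [set set0])
   :|: setX [set set0] (setX (dr a 2) [set set0])
   :|: setX [set set0] (setX [set set0] (dr b 2))
   :|: setX jG (setX (dr a 1) (dr b 1))); last first.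
  by apply/setP=> -[Z [A B]]; rewrite !inE circuit_glue /= -!orbA.
have cG0 : set0 \notin cG by rewrite inE; apply/negP=> /min_joinP[]; rewrite eqxx.
rewrite !card_disjointU ?cardsX ?cards1 ?cdr ?bin1 ?muln1 ?mul1n //.
- move=> [Z [A B]]; rewrite !inE /= => /and3P[cZ _ _].
  by apply: contraNN cG0 => /andP[/eqP<-]; rewrite inE.
- move=> [Z [A B]]; rewrite !inE /= => /orP[] /and3P[cZ /eqP A0 /eqP B0].
    by apply: contraNN cG0 => /andP[/eqP<-]; rewrite inE.
  by rewrite B0 cards0 !andbF.
move=> [Z [A B]]; rewrite !inE /= -orbA => /or3P[] /and3P[_ /eqP A0 /eqP B0].
- by rewrite A0 cards0 andbF.
- by rewrite B0 cards0 !andbF.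
by rewrite A0 cards0 andbF.
Qed.

Lemma card_joins_bundle : #|[set W : {set edge bundle} | @min_join bundle [set Some s; Some t] W]| =
  #|[set Z : {set edge G} | min_join [set s; t] Z]| + a * b.
Proof.
rewrite card_glue; set jG := [set Z | min_join _ Z].
pose dr n k := [set A : {set 'I_n} | #|A| == k].
have cdr n k : #|dr n k| = 'C(n, k) by rewrite card_draws card_ord.
rewrite (_ : [set w | _] = setX jG (setX [set set0] [set set0])
   :|: setX [set set0] (setX (dr a 1) (dr b 1))); last first.
  by apply/setP=> -[Z [A B]]; rewrite !inE join_glue.
rewrite card_disjointU ?cardsX ?cards1 ?cdr ?bin1 ?muln1 ?mul1n //.
move=> [Z [A B]]; rewrite !inE /= => /and3P[_ /eqP A0 _].
by rewrite A0 cards0 andbF.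
Qed.

(** Walks of [G] lift, and the new vertex has two neighbours s and t, at least one
    of which survives the deletion of a vertex. *)
Lemma inseparable_bundle : 0 < a -> 0 < b -> inseparable G -> inseparable bundle.
Proof.
move=> a0 b0 /inseparableP[_ con del].
have lift (F : {set edge G}) V (F' : {set edge bundle}) V' :
    (forall e, e \in F -> inl e \in F') ->
    forall x y, connect (adj ((V, F) : vepair G)) x y ->
      connect (adj ((V', F') : vepair bundle)) (Some x) (Some y).
  move=> FF' x y /connectP[p xp ->] {y}; elim: p x xp => [|z p IHp] x /=; first by rewrite connect0.
  case/andP=> /adjP[e eF eE] zp; apply: connect_trans (connect1 _) (IHp z zp).
  by apply/adjP; exists (inl e); [exact: FF'|rewrite /= eE imsetU !imset_set1].
have toS (H : vepair bundle) : inr (inl (Ordinal a0)) \in H.2 -> connect (adj H) None (Some s).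
  by move=> eH; apply: connect1; apply/adjP; exists (inr (inl (Ordinal a0))); rewrite //= setUC.
have toT (H : vepair bundle) : inr (inr (Ordinal b0)) \in H.2 -> connect (adj H) None (Some t).
  by move=> eH; apply: connect1; apply/adjP; exists (inr (inr (Ordinal b0))); rewrite //= setUC.
have hub (H : vepair bundle) (P : pred (vertex bundle)) z :
    (forall x, P x -> connect (adj H) x z) -> forall x y, P x -> P y -> connect (adj H) x y.
  by move=> toz x y /toz xz /toz yz; apply: connect_trans xz _; rewrite adj_csym.
apply/inseparableP; split; first by exists None.
  move=> x y; apply: (hub _ xpredT (Some s)) => // -[z|] _; last by apply: toS; rewrite inE.
  by apply: lift (con z s) => e _; rewrite inE.
case=> [v|] x y xv yv; last first.
  apply: (hub _ (fun z => z != None) (Some s)) => // -[z|] // _.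
  apply: lift (con z s) => e _; rewrite !inE /=.
  by apply/imsetP => -[].
have delv z w : z != v -> w != v ->
    connect (adj (delete_vertex (Some v : vertex bundle))) (Some z) (Some w).
  move=> zv wv; apply: lift (del v z w zv wv) => e; rewrite !inE /=.
  by apply: contra => /imsetP[u ue [->]].
have [sv|sv] := eqVneq s v.
  have tv : t != v by rewrite -sv eq_sym.
  apply: (hub _ (fun z => z != Some v) (Some t)) => // -[z|] zv; first exact: delv.
  by apply: toT; rewrite !inE /= orbF; apply: contra tv => /eqP[->].
apply: (hub _ (fun z => z != Some v) (Some s)) => // -[z|] zv; first exact: delv.
by apply: toS; rewrite !inE /= orbF; apply: contra sv => /eqP[->].
Qed.

End AddVertex.

Definition realizable c p := exists (G : mgraph) (s t : vertex G),
  [/\ inseparable G, s != t, #|[set Z : {set edge G} | circuit Z]| = c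
    & #|[set Z : {set edge G} | min_join [set s; t] Z]| = p].

Lemma realizable_bundle c p a b : 0 < a -> 0 < b -> realizable c p ->
  realizable (c + 'C(a, 2) + 'C(b, 2) + p * (a * b)) (p + a * b).
Proof.
move=> a0 b0 [G [s [t [insG st cG pG]]]]; exists (bundle s t a b), (Some s), (Some t); split=> //.
- exact: inseparable_bundle.
- by rewrite card_circuits_bundle // cG pG.
by rewrite card_joins_bundle // pG.
Qed.

Lemma realizable_count c p : 0 < c -> realizable c p -> cycle_count_number c.
Proof. by move=> c0 [G [s [t [insG _ cG _]]]]; split=> //; exists G; rewrite num_cyclesE. Qed.

(** * Counting by enumeration in small graphs *)

Section ListGraph.
Variables (n : nat) (L : seq (nat * nat)).

Definition wf_edges := all (fun p : nat * nat => [&& p.1 <= n, p.2 <= n & p.1 != p.2]) L.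
Hypothesis wfL : wf_edges.

Definition nth_edge k := nth (0, 0) L k.

(** The [inord] are harmless because well-formed lists only use numbers up to
    [n]. *)
Definition list_ends (e : 'I_(size L)) : {set 'I_n.+1} :=
  [set inord (nth_edge e).1; inord (nth_edge e).2].

Lemma nth_edge_wf (e : 'I_(size L)) :
  [/\ (nth_edge e).1 <= n, (nth_edge e).2 <= n & (nth_edge e).1 != (nth_edge e).2].
Proof. exact/and3P/(allP wfL)/mem_nth. Qed.

Lemma inord_eq x y : x <= n -> y <= n -> (inord x == inord y :> 'I_n.+1) = (x == y).
Proof. by move=> xn yn; rewrite -val_eqE /= !inordK. Qed.

Lemma card_list_ends e : #|list_ends e| = 2.
Proof. by have [n1 n2 n12] := nth_edge_wf e; rewrite cards2 inord_eq // n12. Qed.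

Definition list_graph := MGraph card_list_ends.

Definition incident (p : nat * nat) x := (p.1 == x) || (p.2 == x).

Fixpoint parity (l : seq (nat * nat)) (b : bitseq) x :=
  match l, b with
  | p :: l', c :: b' => (c && incident p x) (+) parity l' b' x
  | _, _ => false
  end.

Definition edge_set (b : bitseq) : {set edge list_graph} := [set e : 'I_(size L) | nth false b e].

Lemma mem_list_ends (e : edge list_graph) x : x <= n ->
  ((inord x : vertex list_graph) \in ends e) = incident (nth_edge e) x.
Proof.
move=> xn; have [n1 n2 _] := nth_edge_wf e.
by rewrite !inE !inord_eq // /incident ![x == _]eq_sym.
Qed.

Lemma parityE l b x :
  parity l b x = \big[addb/false]_(k < size l) (incident (nth (0, 0) l k) x && nth false b k).
Proof.
elim: l b => [|p l IHl] [|c b]; rewrite ?big_ord0 //; last by rewrite big_ord_recl /= IHl andbC.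
by rewrite big1 // => k _; rewrite nth_nil andbF.
Qed.

Lemma boundary_edge_set b x : x <= n ->
  ((inord x : vertex list_graph) \in boundary (edge_set b)) = parity L b x.
Proof.
move=> xn; rewrite boundaryE parityE big_mkcond; apply: eq_bigr => e _.
by rewrite mem_list_ends // inE; case: ifP.
Qed.

Lemma edge_set_inj : {in [pred b | size b == size L] &, injective edge_set}.
Proof.
move=> b c; rewrite !inE => /eqP sb /eqP sc /setP bc.
apply: (@eq_from_nth _ false) => [|k]; rewrite ?sb ?sc // => kL.
by have := bc (Ordinal kL); rewrite !inE.
Qed.

Lemma edge_set_surj (Z : {set edge list_graph}) : exists2 b, size b = size L & Z = edge_set b.
Proof.
exists [seq e \in Z | e <- enum 'I_(size L)]; first by rewrite size_map size_enum_ord.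
apply/setP=> e; by rewrite inE (nth_map e) ?size_enum_ord ?nth_ord_enum.
Qed.

Definition joins (tgt : pred nat) :=
  [seq b <- vecs (size L) | has id b && all (fun x => parity L b x == tgt x) (iota 0 n.+1)].

Definition minimal_joins tgt :=
  [seq b <- joins tgt | all (fun c => ~~ submask c b true) (joins tgt)].

Definition target (tgt : pred nat) : {set vertex list_graph} := [set x : 'I_n.+1 | tgt x].

Lemma edge_set_sub b c : size b = size L ->
  reflect (forall k, nth false b k -> nth false c k) (edge_set b \subset edge_set c).
Proof.
move=> sb; apply: (iffP subsetP) => [bc k bk|bc e]; last by rewrite !inE; apply: bc.
have kL : k < size L by rewrite -sb ltnNge; apply: contraTN bk => /(nth_default false)->.
by have := bc (Ordinal kL); rewrite !inE; apply.
Qed.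

Lemma mem_joins tgt b : size b = size L ->
  (b \in joins tgt) = (edge_set b != set0) && (boundary (edge_set b) == target tgt).
Proof.
move=> sb; rewrite mem_filter mem_vecs sb eqxx andbT; congr (_ && _).
  apply/hasP/set0Pn=> [[c cb cT]|[e]]; last first.
    rewrite inE => be; exists true => //; rewrite -be mem_nth // sb; exact: ltn_ord.
  have kL : index c b < size L by rewrite -sb index_mem.
  by exists (Ordinal kL); rewrite inE /= nth_index.
apply/allP/eqP => [par|bT x]; last first.
  rewrite mem_iota add0n ltnS => xn; rewrite -boundary_edge_set // bT inE inordK //.
apply/setP=> x; have xn : x <= n by rewrite -ltnS; apply: ltn_ord.
rewrite -[x in LHS]inord_val boundary_edge_set // inE; apply/eqP/par.
by rewrite mem_iota.
Qed.

Lemma card_min_join tgt :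
  #|[set Z : {set edge list_graph} | min_join (target tgt) Z]| = size (minimal_joins tgt).
Proof.
have szJ b : b \in joins tgt -> size b = size L by rewrite mem_filter mem_vecs => /andP[_ /eqP].
rewrite -(size_map edge_set); set l := map _ _.
have ul : uniq l.
  rewrite map_inj_in_uniq ?filter_uniq ?vecs_uniq // => b c.
  rewrite !mem_filter !mem_vecs => /and3P[_ _ sb] /and3P[_ _ sc]; exact: edge_set_inj.
rewrite -(card_uniqP ul); apply: eq_card => Z; have [b sb ->] := edge_set_surj Z.
rewrite inE; apply/min_joinP/mapP => [[b0 bT minb]|[c]].
  exists b => //; rewrite mem_filter mem_joins // b0 bT eqxx !andbT.
  apply/allP=> c cJ; have sc := szJ c cJ; apply/proper_submaskP; first by rewrite sb.
  case=> cb neq; case: neq; apply: edge_set_inj; rewrite ?inE ?sb ?sc //.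
  move: cJ; rewrite mem_joins // => /andP[c0 /eqP cT]; apply: minb => //.
  exact/edge_set_sub.
rewrite mem_filter => /andP[/allP minc cJ] bc; have sc := szJ c cJ.
have {}bc : b = c by apply: edge_set_inj; rewrite ?inE ?sb ?sc.
rewrite {}bc {b sb} in minc *; move: (cJ); rewrite mem_joins // => /andP[c0 /eqP cT].
split=> // F; have [d sd ->] := edge_set_surj F => /(edge_set_sub _ sd) dc d0 dT.
have /minc/proper_submaskP : d \in joins tgt by rewrite mem_joins // d0 dT eqxx.
rewrite sd sc => /(_ erefl) ndc; congr edge_set; apply/eqP/negPn/negP=> /eqP dneq.
by apply: ndc.
Qed.

Definition expand (keep : pred (nat * nat)) (S : seq nat) :=
  S ++ [seq p.2 | p <- L & keep p && (p.1 \in S)] ++ [seq p.1 | p <- L & keep p && (p.2 \in S)].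

Lemma expand_connect (keep : pred (nat * nat)) (H : vepair list_graph) x k :
    (forall e : 'I_(size L), keep (nth_edge e) -> e \in H.2) -> x <= n ->
  forall y, y \in iter k (expand keep) [:: x] -> connect (adj H) (inord x) (inord y) && (y <= n).
Proof.
move=> keepH xn; elim: k => [|k IHk] y /=; first by rewrite inE => /eqP->; rewrite connect0.
have step p z : p \in L -> keep p -> z \in [:: p.1; p.2] ->
    connect (adj H) (inord x) (inord z) -> forall w, w \in [:: p.1; p.2] ->
    connect (adj H) (inord x) (inord w) && (w <= n).
  move=> pL kp zp xz w wp; have /and3P[p1n p2n _] := allP wfL p pL.
  rewrite andbC; apply/andP; split; first by move: wp; rewrite !inE => /orP[]/eqP->.
  have iL : index p L < size L by rewrite index_mem.
  have eE : nth_edge (Ordinal iL) = p by rewrite /nth_edge nth_index.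
  have [-> //|zw] := eqVneq w z.
  apply: connect_trans xz (connect1 _); apply/adjP; exists (Ordinal iL).
    by apply: keepH; rewrite eE.
  rewrite /= /list_ends eE; move: zp wp zw; rewrite !inE.
  by case/orP=> /eqP-> /orP[]/eqP->; rewrite ?eqxx // setUC.
have mem1 (p : nat * nat) : p.1 \in [:: p.1; p.2] by rewrite !inE eqxx.
have mem2 (p : nat * nat) : p.2 \in [:: p.1; p.2] by rewrite !inE eqxx orbT.
rewrite !mem_cat => /or3P[/IHk//||] /mapP[p]; rewrite mem_filter => /andP[/andP[kp pS] pL] ->.
  by have /andP[xz _] := IHk _ pS; apply: (step p p.1 pL kp (mem1 p) xz p.2 (mem2 p)).
by have /andP[xz _] := IHk _ pS; apply: (step p p.2 pL kp (mem2 p) xz p.1 (mem1 p)).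
Qed.

(** Deleting the vertex [n.+1], which does not exist, stands for the whole graph.
    The closure starts from 0, or from 1 when 0 is deleted; [n] rounds suffice. *)
Definition inseparable_check :=
  all (fun v => all (fun y => (y == v) ||
         (y \in iter n (expand (fun p => ~~ incident p v)) [:: (v == 0) : nat])) (iota 0 n.+1))
    (iota 0 n.+2).

Lemma list_inseparable : 0 < n -> inseparable_check -> inseparable list_graph.
Proof.
move=> n0 /allP chk.
have con v (H : vepair list_graph) : v <= n.+1 ->
    (forall e : 'I_(size L), ~~ incident (nth_edge e) v -> e \in H.2) ->
    forall x y : 'I_n.+1, x != v :> nat -> y != v :> nat -> connect (adj H) x y.
  move=> vn keepH; have /chk/allP chkv : v \in iota 0 n.+2 by rewrite mem_iota.
  have hub (x : 'I_n.+1) : x != v :> nat -> connect (adj H) (inord (v == 0)) x.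
    move=> xv; have := chkv x; rewrite mem_iota (negPf xv) /= => /(_ (ltn_ord x)) xS.
    have [] := andP (@expand_connect _ H (v == 0) n keepH _ x xS); first by case: (v == 0).
    by rewrite inord_val.
  by move=> x y /hub xh /hub yh; apply: connect_trans yh; rewrite adj_csym.
apply/inseparableP; split; first by exists ord0.
  move=> x y; apply: (con n.+1) => // [e _||]; first by rewrite inE.
    by rewrite neq_ltn ltn_ord.
  by rewrite neq_ltn ltn_ord.
move=> v x y xv yv; apply: (con (v : 'I_n.+1)) => // [|e]; first by rewrite ltnW // ltnS -ltnS ltn_ord.
by rewrite -mem_list_ends ?inord_val ?inE // -ltnS ltn_ord.
Qed.

End ListGraph.

(** The largest vertex, the edges, and the pair of marked vertices. *)
Definition graph_data := (nat * seq (nat * nat) * (nat * nat))%type.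
Definition admissible (g : graph_data) :=
  let: (n, L, (s, t)) := g in
  [&& 0 < n, wf_edges n L, s <= n, t <= n, s != t & inseparable_check n L].
Definition counts (g : graph_data) :=
  let: (n, L, (s, t)) := g in
  (size (minimal_joins n L pred0), size (minimal_joins n L (pred2 s t))).

Lemma realizable_list g : admissible g -> realizable (counts g).1 (counts g).2.
Proof.
case: g => [[n L] [s t]] /and5P[n0 wfL sn tn /andP[st insL]].
exists (list_graph wfL), (inord s), (inord t); split.
- exact: list_inseparable.
- by rewrite inord_eq.
- by rewrite (_ : set0 = target wfL pred0) ?card_min_join //; apply/setP=> x; rewrite !inE.
rewrite (_ : [set _; _] = target wfL (pred2 s t)) ?card_min_join //.
by apply/setP=> x; rewrite !inE /= -!val_eqE /= !inordK.
Qed.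

(** An edge, K_4 minus an edge, and graphs of cyclomatic number up to 4, some with
    the marked vertices on subdivided edges. They were found by a search for pairs
    (c, p) from which the numbers that the first two miss can be reached. *)
Definition starts : seq graph_data := [::
  (1, [:: (0,1)], (0,1));
  (3, [:: (0,1);(0,2);(1,2);(2,3);(3,1)], (0,3));
  (4, [:: (0,2);(2,3);(3,1);(2,3);(1,2);(0,3);(0,4);(4,1)], (2,4));
  (3, [:: (0,1);(0,2);(1,2);(0,2);(2,3);(3,1)], (0,3));
  (4, [:: (0,1);(0,2);(3,1);(2,3);(2,4);(4,3);(1,4);(0,4)], (0,3));
  (3, [:: (0,1);(0,2);(2,3);(3,1);(2,3);(1,3);(0,2)], (0,1));
  (5, [:: (0,2);(3,1);(2,3);(0,1);(0,4);(4,1);(2,5);(5,3)], (4,5));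
  (5, [:: (0,2);(3,1);(2,3);(2,3);(0,1);(0,4);(4,1);(2,5);(5,3)], (4,5));
  (6, [:: (0,2);(3,1);(2,3);(0,4);(3,4);(0,1);(2,5);(5,3);(4,6);(6,1)], (5,6))].

Lemma starts_admissible : all admissible starts.
Proof. by vm_compute. Qed.

Lemma starts_counts : map counts starts =
 [:: (0, 1); (3, 4); (12, 8); (6, 6); (13, 9); (11, 9); (6, 8); (10, 12); (12, 14)].
Proof. by vm_compute. Qed.

(** * Which numbers are attained *)

Lemma bin2D m n : 'C(m + n, 2) = 'C(m, 2) + 'C(n, 2) + m * n.
Proof.
elim: n => [|n IHn]; first by rewrite addn0 muln0 !addn0.
by rewrite addnS !binS !bin1 IHn mulnS; lia.
Qed.

(** Parallel edges have deficiency 0, and deficiencies add up when graphs are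
    joined in parallel at the marked vertices. *)
Definition deficient p d := exists2 c, realizable c p & c + d = 'C(p, 2).

Lemma deficient_bundle a b e p d : 0 < a -> 0 < b -> 'C(a * b, 2) = 'C(a, 2) + 'C(b, 2) + e ->
  deficient p d -> deficient (p + a * b) (d + e).
Proof.
move=> a0 b0 ab [c real_c cd]; exists (c + 'C(a, 2) + 'C(b, 2) + p * (a * b)).
  exact: realizable_bundle.
by rewrite bin2D ab -cd; lia.
Qed.

Lemma deficient_bundles a b e k p d : 0 < a -> 0 < b -> 'C(a * b, 2) = 'C(a, 2) + 'C(b, 2) + e ->
  deficient p d -> deficient (p + k * (a * b)) (d + k * e).
Proof.
move=> a0 b0 ab def; elim: k => [|k IHk]; first by rewrite !mul0n !addn0.
by rewrite !mulSnr !addnA; apply: deficient_bundle.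
Qed.

Definition start_deficiencies : seq (nat * nat) :=
  [:: (1, 0); (4, 3); (8, 16); (6, 9); (9, 23); (9, 25); (8, 22); (12, 56); (14, 79)].

Lemma deficient_start p d : (p, d) \in start_deficiencies -> deficient p d.
Proof.
move=> pd; have /mapP[[c q] cq [-> ->]] :
  (p, d) \in [seq (x.2, 'C(x.2, 2) - x.1) | x <- map counts starts].
  by rewrite starts_counts.
have le_c : c <= 'C(q, 2).
  have: all (fun x => x.1 <= 'C(x.2, 2)) (map counts starts) by rewrite starts_counts.
  by move/allP=> /(_ _ cq).
have /mapP[g gS gE] := cq; exists c; last by rewrite subnKC.
by have := realizable_list (allP starts_admissible g gS); rewrite -gE.
Qed.

(** Which deficiencies arise from a start by j operations of type (2,3), k of type
    (2,4), and as many of type (2,2) as needed: these add the same amount 4 to the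
    deficiency and to the number of paths. Operations of type (1,1) raise the
    number of paths freely. The bounds on j and k are large enough for the
    two evaluations below. *)
Definition reached m d := has (fun s : nat * nat => has (fun k => has (fun j =>
    let e := s.2 + 11 * j + 21 * k in
    [&& e <= d, 4 %| d - e & s.1 + (d - e) + 6 * j + 8 * k <= m])
  (iota 0 8)) (iota 0 5)) start_deficiencies.

Lemma reached_deficient m d : reached m d -> deficient m d.
Proof.
case/hasP=> -[p e] /deficient_start def /hasP[k _] /hasP[j _] /and3P[/= le_e /dvdnP[i iE] le_m].
have := @deficient_bundles 1 1 0 (m - (p + (d - (e + 11 * j + 21 * k)) + 6 * j + 8 * k)) _ _ isT isT erefl
  (@deficient_bundles 2 2 4 i _ _ isT isT erefl
  (@deficient_bundles 2 3 11 j _ _ isT isT erefl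
  (@deficient_bundles 2 4 21 k _ _ isT isT erefl def))).
by congr deficient; lia.
Qed.

(** One operation of type (2,4) leads from (m - 8, d - 21) to (m, d) and stays in
    the window 11 <= d < 11 + m as soon as d >= 32; smaller d come from m - 1. *)
Lemma deficient_large m d : 15 <= m -> 11 <= d < 11 + m -> deficient m d.
Proof.
elim/ltn_ind: m d => m IHm d m15 dm.
have [m23|m23] := ltnP m 23.
  apply: reached_deficient.
  have base : all (fun m => all (reached m) (iota 11 m)) (iota 15 8) by vm_compute.
  by apply: (allP (allP base m _)); rewrite mem_iota //; lia.
have [d32|d32] := leqP 32 d.
  have := @deficient_bundle 2 4 21 (m - 8) (d - 21) isT isT erefl.
  rewrite !subnK; [apply; apply: IHm; lia | lia | lia].
have := @deficient_bundle 1 1 0 m.-1 d isT isT erefl.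
rewrite addn0 addn1 prednK; [apply; apply: IHm; lia | lia].
Qed.

Lemma deficient_count m n : 0 < n <= 'C(m, 2) -> deficient m ('C(m, 2) - n) -> cycle_count_number n.
Proof.
case/andP=> n0 nm [c real_c cE]; have cn : c = n by lia.
by rewrite cn in real_c; apply: realizable_count real_c.
Qed.

(** Let m be least with n + 11 <= C(m,2). As C(m,2) - C(m-1,2) = m - 1, the
    deficiency C(m,2) - n falls in the window of [deficient_large]. *)
Lemma cycle_count_number_exists n :
  0 < n -> n \notin [:: 2; 4; 5; 8; 9; 16] -> cycle_count_number n.
Proof.
move=> n0 nbad; have [n80|n80] := leqP n 80.
  have small : all (fun n => (n \in [:: 2; 4; 5; 8; 9; 16]) ||
      has (fun m => (n <= 'C(m, 2)) && reached m ('C(m, 2) - n)) (iota 0 17)) (iota 1 80).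
    by vm_compute.
  have := allP small n; rewrite mem_iota n0 ltnS n80 (negPf nbad).
  case/(_ isT)/hasP=> m _ /andP[le_m r].
  by apply: (@deficient_count m); rewrite ?n0 //; apply: reached_deficient.
have exM : exists m, n + 11 <= 'C(m, 2).
  by exists (n + 12); rewrite bin2D [in X in X <= _]addnC -[12]/(11 + 1) addnA; lia.
case: (ex_minnP exM) => m le_m min_m.
have m15 : 15 <= m.
  rewrite ltnNge; apply/negP=> m14; have := leq_bin2l 2 m14.
  rewrite (_ : 'C(14, 2) = 91) //; lia.
have lt_m : 'C(m.-1, 2) < n + 11.
  by rewrite ltnNge; apply/negP=> /min_m; lia.
have mE : 'C(m, 2) = 'C(m.-1, 2) + m.-1.
  by rewrite -{1}(ltn_predK m15) binS bin1.
by apply: (@deficient_count m); [lia | apply: deficient_large; lia].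
Qed.

Theorem theorem1 (n : nat) (n_gt0 : 0 < n) :
  cycle_count_number n <-> n \notin [:: 2; 4; 5; 8; 9; 16].
Proof.
split; last exact: cycle_count_number_exists.
by case=> _ [G [insG <-]]; apply: num_cycles_inseparable.
Qed.
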